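(* There is an algorithm that, given a CNF formula with $n$ variables and $m$ clauses together with a $k$-interval ordering of it, solves #SAT and weighted MaxSAT for this formula in time $O(m^3 4^k (m+n))$.
   Context: A variable appears in a clause if it occurs there as a positive or negative literal. Let $k\ge 0$ be an integer. A $k$-interval ordering of a CNF formula is a total order $<$ on the union of its variables and clauses such that for every clause $C$ there are at most $k$ variables $x$ not appearing in $C$ for which at least one of the following holds: (1) some variable $x'$ appears in $C$ with $x'<x<C$; (2) $x$ appears in some clause $C'$ with $C'<C<x$. #SAT: compute the number of satisfying truth assignments of the formula. Weighted MaxSAT: given in addition a weight for each clause, find a truth assignment maximizing the total weight of satisfied clauses. *)

(* Defs.v *)
From mathcomp Require Import all_boot all_order all_algebra.

Set Implicit Arguments.
Unset Strict Implicit.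
Unset Printing Implicit Defensive.

Import Order.TTheory GRing.Theory Num.Theory.

(** * CNF formulas *)

(* A clause is a set of literals: [(x, true)] is the literal x, [(x, false)] its
   negation.  Empty and tautological clauses are allowed.  *)
Definition clause (n : nat) : Type := {set 'I_n * bool}.

(* Clauses are indexed by ['I_m], so that a clause may be repeated; a variable
   need not occur in any clause.  *)
Definition cnf (n m : nat) : Type := 'I_m -> clause n.

Definition appears (n : nat) (x : 'I_n) (C : clause n) : bool :=
  ((x, true) \in C) || ((x, false) \in C).

Definition assignment (n : nat) : Type := {ffun 'I_n -> bool}.

Definition sat_clause (n : nat) (a : {ffun 'I_n -> bool}) (C : clause n) : bool :=
  [exists l : 'I_n * bool, (l \in C) && (a l.1 == l.2)].

Definition sat_cnf (n m : nat) (a : {ffun 'I_n -> bool}) (F : cnf n m) : bool :=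
  [forall j : 'I_m, sat_clause a (F j)].

Definition count_sat (n m : nat) (F : cnf n m) : nat :=
  #|[set a : {ffun 'I_n -> bool} | sat_cnf a F]|.

Definition sat_weight (R : realDomainType) (n m : nat) (F : cnf n m)
    (w : 'I_m -> R) (a : {ffun 'I_n -> bool}) : R :=
  (\sum_(j < m | sat_clause a (F j)) w j)%R.

Definition maximizes_weight (R : realDomainType) (n m : nat) (F : cnf n m)
    (w : 'I_m -> R) (a : {ffun 'I_n -> bool}) : Prop :=
  forall b : {ffun 'I_n -> bool}, (sat_weight F w b <= sat_weight F w a)%R.

(** * Interval orderings *)

Definition strict_total_order (T : eqType) (lt : rel T) : Prop :=
  [/\ irreflexive lt, transitive lt & forall x y, x != y -> lt x y || lt y x].

(* Orderings are on ['I_n + 'I_m]: [inl x] is a variable, [inr j] a clause.  *)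
Definition exceptional (n m : nat) (F : cnf n m) (lt : rel ('I_n + 'I_m))
    (j : 'I_m) (x : 'I_n) : bool :=
  ~~ appears x (F j) &&
  ([exists x' : 'I_n,
      [&& appears x' (F j), lt (inl x') (inl x) & lt (inl x) (inr j)]]
   || [exists j' : 'I_m,
      [&& appears x (F j'), lt (inr j') (inr j) & lt (inr j) (inl x)]]).

Definition interval_ordering (k n m : nat) (F : cnf n m)
    (lt : rel ('I_n + 'I_m)) : Prop :=
  strict_total_order lt /\
  forall j : 'I_m, #|[set x : 'I_n | exceptional F lt j x]| <= k.

(** * Random access machines

   Programs of a unit-cost RAM with additive arithmetic only (no
   multiplication, division, shift or bitwise operation).  Memory consists of
   infinite arrays of natural numbers and infinite arrays of weights.  The first
   argument of a load or a store is the name of an array.  It is a constant of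
   the program, so that a program uses finitely many arrays (which could be
   interleaved in a single one); a simple variable is a cell of an array.  A
   program contains no constant of type [R] but 0, so that the same program runs
   on integer, rational or real weights.  *)

Inductive iexp : Type :=
| IConst of nat
| ILoad of nat & iexp
| IAdd of iexp & iexp
| ISub of iexp & iexp.

Inductive vexp : Type :=
| VZero
| VLoad of nat & iexp
| VAdd of vexp & vexp
| VSub of vexp & vexp.

Inductive test : Type :=
| TLe of iexp & iexp
| TLeV of vexp & vexp.

Inductive prog : Type :=
| Skip
| IStore of nat & iexp & iexp
| VStore of nat & iexp & vexp
| Seq of prog & prog
| If of test & prog & prog
| While of test & prog.

Record state (R : realDomainType) : Type :=
  State { imem : nat -> nat -> nat; vmem : nat -> nat -> R }.

Fixpoint ieval (mem : nat -> nat -> nat) (e : iexp) : nat :=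
  match e with
  | IConst i => i
  | ILoad x a => mem x (ieval mem a)
  | IAdd e1 e2 => ieval mem e1 + ieval mem e2
  | ISub e1 e2 => ieval mem e1 - ieval mem e2
  end.

Fixpoint veval (R : realDomainType) (s : state R) (e : vexp) : R :=
  match e with
  | VZero => 0%R
  | VLoad x a => vmem s x (ieval (imem s) a)
  | VAdd e1 e2 => (veval s e1 + veval s e2)%R
  | VSub e1 e2 => (veval s e1 - veval s e2)%R
  end.

Definition teval (R : realDomainType) (s : state R) (b : test) : bool :=
  match b with
  | TLe e1 e2 => ieval (imem s) e1 <= ieval (imem s) e2
  | TLeV e1 e2 => (veval s e1 <= veval s e2)%R
  end.

Definition upd (T : Type) (mem : nat -> nat -> T) (x i : nat) (v : T) :
    nat -> nat -> T :=
  fun y j => if (y == x) && (j == i) then v else mem y j.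

(* [exec p s t s']: started in state [s], the program [p] halts in state [s']
   after [t] time units.  Each assignment and each test costs one unit; the
   expressions occurring in a fixed program have bounded size, so charging for
   every arithmetic operation and memory access instead would only change the
   time by a constant factor depending on the program.  *)
Inductive exec (R : realDomainType) :
    prog -> state R -> nat -> state R -> Prop :=
| ExecSkip s : exec Skip s 1 s
| ExecIStore x a e s :
    exec (IStore x a e) s 1
      (State (upd (imem s) x (ieval (imem s) a) (ieval (imem s) e)) (vmem s))
| ExecVStore x a e s :
    exec (VStore x a e) s 1
      (State (imem s) (upd (vmem s) x (ieval (imem s) a) (veval s e)))
| ExecSeq p q s1 s2 s3 t u :
    exec p s1 t s2 -> exec q s2 u s3 -> exec (Seq p q) s1 (t + u) s3
| ExecIfTrue b p q s s' t :
    teval s b -> exec p s t s' -> exec (If b p q) s t.+1 s'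
| ExecIfFalse b p q s s' t :
    ~~ teval s b -> exec q s t s' -> exec (If b p q) s t.+1 s'
| ExecWhileTrue b p s1 s2 s3 t u :
    teval s1 b -> exec p s1 t s2 -> exec (While b p) s2 u s3 ->
    exec (While b p) s1 (t + u).+1 s3
| ExecWhileFalse b p s :
    ~~ teval s b -> exec (While b p) s 1 s.

Lemma exec_deterministic (R : realDomainType) (p : prog) (s : state R)
    (t1 t2 : nat) (s1 s2 : state R) :
  exec p s t1 s1 -> exec p s t2 s2 -> t1 = t2 /\ s1 = s2.
Proof.
move=> H; elim: H t2 s2 => {p s t1 s1}
  [s|x a e s|x a e s|p q r1 r2 r3 t u _ IHp _ IHq|b p q r r' t Hb _ IH
  |b p q r r' t Hb _ IH|b p r1 r2 r3 t u Hb _ IHp _ IHw|b p r Hb] t2 s2 H;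
  inversion H; subst => //; try by match goal with
    | h1 : is_true ?x, h2 : is_true (~~ ?x) |- _ => rewrite h1 in h2 end.
- by edestruct IHp; [eassumption | subst; edestruct IHq; [eassumption | subst]].
- by edestruct IH; [eassumption | subst].
- by edestruct IH; [eassumption | subst].
- by edestruct IHp; [eassumption | subst; edestruct IHw; [eassumption | subst]].
Qed.

(** * Inputs and outputs *)

(* The variables are numbered 0, ..., n-1, the clauses n, ..., n+m-1.  *)
Definition code_item (n m : nat) (u : 'I_n + 'I_m) : nat :=
  match u with inl x => nat_of_ord x | inr j => n + j end.

Definition listing (n m : nat) (lt : rel ('I_n + 'I_m)) : seq ('I_n + 'I_m) :=
  sort (fun u v => (u == v) || lt u v) (enum {: 'I_n + 'I_m}).

(* The number of literals, followed by two cells for each literal: its variable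
   and its sign (1 for a positive literal).  *)
Definition code_clause (n : nat) (C : clause n) : seq nat :=
  #|C| :: flatten [seq [:: nat_of_ord l.1; nat_of_bool l.2] | l <- enum C].

(* n, m, the variables and clauses in increasing order, and the clauses.  *)
Definition code_input (n m : nat) (F : cnf n m) (lt : rel ('I_n + 'I_m)) :
    seq nat :=
  [:: n; m] ++ [seq code_item u | u <- listing lt]
    ++ flatten [seq code_clause (F j) | j <- enum 'I_m].

(* The input is at the beginning of the arrays named 0, and all the other cells
   are 0.  *)
Definition initial_state (R : realDomainType) (xs : seq nat) (ws : seq R) :
    state R :=
  State (fun x i => if x == 0 then nth 0 xs i else 0)
        (fun x i => if x == 0 then nth 0%R ws i else 0%R).

(* The output is at the beginning of the array of naturals named 1.  *)
Definition count_output (R : realDomainType) (n m : nat) (F : cnf n m)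
    (s : state R) : Prop :=
  imem s 1 0 = count_sat F.

Definition maxsat_output (R : realDomainType) (n m : nat) (F : cnf n m)
    (w : 'I_m -> R) (s : state R) : Prop :=
  exists a : assignment n,
    maximizes_weight F w a /\ forall x : 'I_n, imem s 1 x = nat_of_bool (a x).

(* Main.v *)
Require Import Defs.
From mathcomp Require Import all_boot all_order all_algebra zify ring.

(* Cut the order into a prefix and a suffix.  As the variables of the prefix vary,
   the set S of clauses of the suffix that they satisfy takes at most m 2^k + 1
   values: if some clause is not satisfied, choose one that starts first; it
   fixes its own variables, at most k variables between its start and the cut
   are not its own, and these values determine which clauses starting later are
   satisfied, while those starting earlier all are.  The symmetric bound holds
   for the set S' of clauses of the prefix satisfied by the variables of the
   suffix.  The table of a cut holds, for each pair (S, S'), the number of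
   assignments of the prefix variables that satisfy exactly S in the suffix and
   every clause of the prefix outside S'; for MaxSAT, it holds the maximal weight
   of the clauses of the prefix that are satisfied or in S', with a back pointer.
   Crossing one item leads from a table to the next one in constant time per
   pair.  On the machine, a set of clauses is a bitmask used as an address: looking
   up a set takes constant time, and computing the set after one more item takes
   time O(m). *)

Set Implicit Arguments.
Unset Strict Implicit.
Unset Printing Implicit Defensive.

Import Order.TTheory GRing.Theory Num.Theory.

(** * Hoare triples with time bounds *)

(** Reversing the order does not exchange the two cases of an exceptional variable, so the bound for
    S' is not a mirror image of the one for S: case (1) is about how far back the variables of a
    clause reach, case (2) about how far back the clauses of a variable do. In both cases, however,
    the variables relevant to a clause on one side of the cut form sets that are totally ordered by
    inclusion; the counting argument only needs such a chain. S evolves forwards and S' backwards: S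
    before an item, S' after it and the value of the item determine the other two sets. A transition
    is therefore indexed by this mixed triple; it has one source and one target, and there are at
    most two transitions for each pair of listed sets. Additive arithmetic cannot update a bitmask
    in constant time. Hence the successors of every single set are computed once and stored; a pair
    then costs only additions and look-ups. S and S' lie on different sides of the cut, so they are
    disjoint and the sum of their masks names the pair faithfully. Each cut owns a fresh block of
    addresses, still filled with zeros, and nothing has to be cleared. *)

Fixpoint ints_written (p : prog) : seq nat :=
  match p with
  | IStore x _ _ => [:: x]
  | Seq p q | If _ p q => ints_written p ++ ints_written q
  | While _ p => ints_written p
  | _ => [::]
  end.

Fixpoint weights_written (p : prog) : seq nat :=
  match p with
  | VStore x _ _ => [:: x]
  | Seq p q | If _ p q => weights_written p ++ weights_written q
  | While _ p => weights_written p
  | _ => [::]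
  end.

Section Triples.

Variable R : realDomainType.
Implicit Types (p q : prog) (s : state R) (b : test) (Q : state R -> Prop).

(** The footprint is syntactic, so that loop invariants need not mention the arrays that the body
    never writes. *)
Definition frame p s s' :=
  (forall x, x \notin ints_written p -> imem s' x = imem s x) /\
  (forall x, x \notin weights_written p -> vmem s' x = vmem s x).

Lemma upd_frame (T : Type) (mem : nat -> nat -> T) x i v y :
  y != x -> upd mem x i v y = mem y.
Proof. by rewrite /upd => /negbTE ->. Qed.

Lemma exec_frame p s t s' : exec p s t s' -> frame p s s'.
Proof.
rewrite /frame.
elim=> {p s t s'}
  [s|x a e s|x a e s|p q s1 s2 s3 t u _ [I1 V1] _ [I2 V2]
  |b p q s s' t _ _ [I V]|b p q s s' t _ _ [I V]
  |b p s1 s2 s3 t u _ _ [I1 V1] _ [I2 V2]|b p s _] //=;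
  split=> //= y; rewrite ?mem_cat ?negb_or.
- by rewrite andbT; apply: upd_frame.
- by rewrite andbT; apply: upd_frame.
- by case/andP=> y1 y2; rewrite I2 ?I1.
- by case/andP=> y1 y2; rewrite V2 ?V1.
- by case/andP=> y1 y2; rewrite I.
- by case/andP=> y1 y2; rewrite V.
- by case/andP=> y1 y2; rewrite I.
- by case/andP=> y1 y2; rewrite V.
- by move=> y1; rewrite I2 ?I1.
- by move=> y1; rewrite V2 ?V1.
Qed.

Lemma frame_trans p s1 s2 s3 : frame p s1 s2 -> frame p s2 s3 -> frame p s1 s3.
Proof.
by move=> [I1 V1] [I2 V2]; split=> x xp; rewrite ?I2 ?I1 ?V2 ?V1.
Qed.

(** Total correctness: a halting run is exhibited. [T] is only an upper bound, so that costs may be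
    rounded up. *)
Definition runs p s T Q := exists t s', [/\ exec p s t s', t <= T & Q s'].

Lemma runs_weak p s T T' Q Q' :
  runs p s T Q -> T <= T' -> (forall s', frame p s s' -> Q s' -> Q' s') ->
  runs p s T' Q'.
Proof.
move=> [t [s' [st tT Qs']]] TT' QQ'; exists t, s'; split=> //.
  exact: leq_trans TT'.
exact: QQ' (exec_frame st) Qs'.
Qed.

Lemma runs_le p s T T' Q : runs p s T Q -> T <= T' -> runs p s T' Q.
Proof. by move=> H /(runs_weak H); apply. Qed.

Lemma runs_post p s T Q Q' :
  runs p s T Q -> (forall s', frame p s s' -> Q s' -> Q' s') -> runs p s T Q'.
Proof. by move=> H; apply: runs_weak H _. Qed.

Lemma runs_skip s Q : Q s -> runs Skip s 1 Q.
Proof. by exists 1, s; split=> //; constructor. Qed.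

Lemma runs_istore x a e s Q :
  Q (State (upd (imem s) x (ieval (imem s) a) (ieval (imem s) e)) (vmem s)) ->
  runs (IStore x a e) s 1 Q.
Proof. by move=> Qs; exists 1; eexists; split; [constructor | | exact: Qs]. Qed.

Lemma runs_vstore x a e s Q :
  Q (State (imem s) (upd (vmem s) x (ieval (imem s) a) (veval s e))) ->
  runs (VStore x a e) s 1 Q.
Proof. by move=> Qs; exists 1; eexists; split; [constructor | | exact: Qs]. Qed.

Lemma runs_bind p q s T U Q1 Q :
  runs p s T Q1 -> (forall s1, frame p s s1 -> Q1 s1 -> runs q s1 U Q) ->
  runs (Seq p q) s (T + U) Q.
Proof.
move=> [t [s1 [st tT Qs1]]] /(_ s1 (exec_frame st) Qs1) [u [s2 [s1u uU Qs2]]].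
by exists (t + u), s2; split; [exact: ExecSeq s1u | exact: leq_add |].
Qed.

Lemma runs_seq p q s T U Q :
  runs p s T (fun s1 => runs q s1 U Q) -> runs (Seq p q) s (T + U) Q.
Proof. by move=> H; apply: runs_bind H _. Qed.

(** The bounds of the branches are added rather than maximized: bounds left to unification then
    build a plain sum, compared once by [runs_le]. *)
Lemma runs_if b p q s T U Q :
  (teval s b -> runs p s T Q) -> (~~ teval s b -> runs q s U Q) ->
  runs (If b p q) s (T + U).+1 Q.
Proof.
move=> Hp Hq; case/boolP: (teval s b) => Hb.
- have [t [s' [st tT Qs']]] := Hp Hb; exists t.+1, s'.
  by split; [exact: ExecIfTrue | rewrite ltnS (leq_trans tT) ?leq_addr |].
- have [t [s' [st tT Qs']]] := Hq Hb; exists t.+1, s'.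
  by split; [exact: ExecIfFalse | rewrite ltnS (leq_trans tT) ?leq_addl |].
Qed.

(** [I i] holds after [i] iterations and [h] is their exact number. Each iteration pays for its
    test, and the last unit is the failing test. Both premises provide the frame relative to the
    state before the loop. *)
Lemma runs_while b p s (h T : nat) (I : nat -> state R -> Prop) :
  I 0 s ->
  (forall i s', frame p s s' -> i < h -> I i s' ->
     teval s' b /\ runs p s' T (I i.+1)) ->
  (forall s', frame p s s' -> I h s' -> ~~ teval s' b) ->
  runs (While b p) s (h * T.+1).+1 (I h).
Proof.
move=> I0 Hbody Hstop.
suff H d i s' : d + i = h -> frame p s s' -> I i s' ->
    runs (While b p) s' (d * T.+1).+1 (I h).
  by apply: (H h 0) => //; rewrite addn0.
elim: d i s' => [|d IHd] i s' dih fr Ii.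
  move: dih Ii; rewrite add0n => -> Ih; exists 1, s'.
  by split=> //; apply/ExecWhileFalse/Hstop.
have [|Hb [t [s1 [st tT Is1]]]] := Hbody i s' fr _ Ii.
  by rewrite -dih addSn ltnS leq_addl.
have [||u [s2 [s1u uU Is2]]] := IHd i.+1 s1 _ _ Is1.
- by rewrite addnS -addSn.
- exact: frame_trans (exec_frame st).
exists (t + u).+1, s2; split=> //; first exact: ExecWhileTrue s1u.
by rewrite mulSn addSn !ltnS -addnS leq_add.
Qed.

End Triples.

(** * Sets of clauses satisfied by the variables of a cut *)

Section Masks.

Variable m : nat.
Implicit Types (Z X Y : {set 'I_m}).

Definition bitmask Z : nat := \sum_(j in Z) 2 ^ j.

Definition below (j : nat) Z := [set o in Z | o < j].
Definition above (j : nat) Z := [set o in Z | j <= o].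

Lemma bitmask0 : bitmask set0 = 0.
Proof. by rewrite /bitmask big_set0. Qed.

Lemma bitmaskU X Y : [disjoint X & Y] -> bitmask (X :|: Y) = bitmask X + bitmask Y.
Proof.
by move=> XY; rewrite /bitmask -bigU //=; apply: eq_bigl => j; rewrite !inE.
Qed.

Lemma bitmaskD1 Z c : bitmask Z = (c \in Z) * 2 ^ c + bitmask (Z :\ c).
Proof.
rewrite /bitmask; case cZ: (c \in Z); first by rewrite mul1n (big_setD1 c).
by rewrite mul0n add0n; congr bitmask; apply/setP=> j; rewrite !inE; case: eqP => // ->.
Qed.

Lemma below0 Z : below 0 Z = set0.
Proof. by apply/setP=> o; rewrite !inE ltn0 andbF. Qed.

Lemma below_top Z : below m Z = Z.
Proof. by apply/setP=> o; rewrite !inE ltn_ord andbT. Qed.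

Lemma above0 Z : above 0 Z = Z.
Proof. by apply/setP=> o; rewrite !inE andbT. Qed.

Lemma above_top Z : above m Z = set0.
Proof. by apply/setP=> o; rewrite !inE leqNgt ltn_ord andbF. Qed.

Lemma bitmask_belowS (j : 'I_m) Z :
  bitmask (below j.+1 Z) = (j \in Z) * 2 ^ j + bitmask (below j Z).
Proof.
rewrite (bitmaskD1 _ j) !inE ltnSn andbT; congr (_ + bitmask _).
apply/setP=> o; rewrite !inE ltnS (ltn_neqAle o j) -val_eqE /=.
by case: (o \in Z); rewrite ?andbF ?andbT.
Qed.

Lemma bitmask_above (j : 'I_m) Z :
  bitmask (above j Z) = (j \in Z) * 2 ^ j + bitmask (above j.+1 Z).
Proof.
rewrite (bitmaskD1 _ j) !inE leqnn andbT; congr (_ + bitmask _).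
apply/setP=> o; rewrite !inE (ltn_neqAle j o) -val_eqE /= [j == _ :> nat]eq_sym.
by case: (o \in Z); rewrite ?andbF ?andbT.
Qed.

Lemma bitmask_below_lt j Z : j <= m -> bitmask (below j Z) < 2 ^ j.
Proof.
elim: j => [|j IHj] jm; first by rewrite below0 bitmask0.
rewrite (bitmask_belowS (Ordinal jm)) /= expnS mul2n -addnn.
by case: (_ \in Z); have := IHj (ltnW jm); lia.
Qed.

Lemma bitmask_lt Z : bitmask Z < 2 ^ m.
Proof. by rewrite -{1}(below_top Z) bitmask_below_lt. Qed.

(** The powers below [2 ^ j] sum to less than [2 ^ j], so a comparison reads the top bit of a
    truncated mask; this replaces bitwise operations on the machine. *)
Lemma pow_le_bitmask_below (j : 'I_m) Z :
  (2 ^ j <= bitmask (below j.+1 Z)) = (j \in Z).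
Proof.
rewrite bitmask_belowS; have := bitmask_below_lt Z (ltnW (ltn_ord j)).
by case: (j \in Z); lia.
Qed.

Lemma bitmask_inj : injective bitmask.
Proof.
move=> X Y XY.
(* Bits are read from the top: once the truncations to [m - j] bits have equal masks, a comparison
   shows that the bit [m - j.+1] is the same, and it is cancelled. *)
suff H j : j <= m -> bitmask (below (m - j) X) = bitmask (below (m - j) Y).
  apply/setP=> o; rewrite -(pow_le_bitmask_below o X) -(pow_le_bitmask_below o Y).
  have := H (m - o.+1) (leq_subr _ _); rewrite subKn //.
  by move=> ->.
elim: j => [|j IHj] jm; first by rewrite subn0 !below_top.
have lt_mj : m - j.+1 < m by lia.
have := IHj (ltnW jm); rewrite -subSS subSn // => E.
have := pow_le_bitmask_below (Ordinal lt_mj) X.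
have := pow_le_bitmask_below (Ordinal lt_mj) Y.
rewrite /= -E => -> XYj; move: E; rewrite !(bitmask_belowS (Ordinal lt_mj)) -XYj.
exact: addnI.
Qed.

End Masks.

(** * Counting satisfied sets along a chain of variable sets *)

Section ChainBound.

Variables (n m k : nat) (F : cnf n m).

Definition satisfied_on (X : pred 'I_n) (a : {ffun 'I_n -> bool}) (j : 'I_m) :=
  [exists l : 'I_n * bool, [&& l \in F j, X l.1 & a l.1 == l.2]].

(** [X] is one side of a cut and [B] the clauses of the other side; [U j] holds the variables of [X]
    that matter to [j], and is chosen differently for the order and for its reverse. *)
Variables (X : pred 'I_n) (B : {set 'I_m}) (U : 'I_m -> {set 'I_n}).

Let V j := [set x | appears x (F j)].

Hypothesis UX : forall j x, j \in B -> appears x (F j) -> X x -> x \in U j.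
Hypothesis Uk : forall j, j \in B -> #|U j :\: V j| <= k.
Hypothesis U_chain :
  forall j j', j \in B -> j' \in B -> U j \subset U j' \/ U j' \subset U j.

(** A variable of [j] receives the value that falsifies its literal, hence true for a negative one.
    Values outside [U j] are arbitrary: [guessed] evaluates only clauses whose variables in [X] lie
    in [U j]. *)
Let guess j (T : {set 'I_n}) : {ffun 'I_n -> bool} :=
  [ffun x => if x \in U j :\: V j then x \in T else (x, false) \in F j].

Let guessed j T := [set j' in B |
  ~~ [forall x, appears x (F j') && X x ==> (x \in U j)]
  || satisfied_on X (guess j T) j'].

(* An unsatisfied clause [j] with [U j] maximal fixes the values of its own
   variables; once the at most [k] other variables of [U j] are guessed, the
   clauses whose variables lie in [U j] are determined, and the other ones are
   satisfied by maximality. *)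
Lemma chain_cover a : let Z := [set j in B | satisfied_on X a j] in
  Z = B \/ exists2 j, j \in B &
    exists2 T, T \in powerset (U j :\: V j) & Z = guessed j T.
Proof.
move=> Z; case: (boolP (B \subset Z)) => [BZ|/subsetPn[j0 j0B j0Z]].
  left; apply/eqP; rewrite eqEsubset BZ andbT.
  by apply/subsetP=> j; rewrite inE => /andP[].
right.
pose P := [pred j | (j \in B) && (j \notin Z)].
have Pj0 : P j0 by rewrite /= j0B.
have [j /andP[jB jZ] jmax] := arg_maxnP (fun j => #|U j|) Pj0.
exists j => //; exists [set x in U j :\: V j | a x].
  by rewrite inE; apply/subsetP=> x; rewrite inE => /andP[].
have a_guess x : x \in U j -> X x -> 
    guess j [set x in U j :\: V j | a x] x = a x.
  move=> xU Xx; rewrite ffunE; case: ifP => xUV; first by rewrite inE xUV.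
  have xV : appears x (F j) by move: xUV; rewrite !inE xU andbT; case: appears.
  have unsat b : (x, b) \in F j -> a x = ~~ b.
    move=> xb; apply/eqP; move: jZ; rewrite inE jB /= => /existsPn/(_ (x, b)).
    by rewrite /= xb Xx /=; case: (a x); case: b {xb}.
  case: (boolP ((x, false) \in F j)) => [/unsat -> //|xF].
  by move: xV; rewrite /appears (negbTE xF) orbF => /unsat ->.
apply/setP=> j'; rewrite !inE; case j'B: (j' \in B) => //=.
case: forallP => [sub|nsub] /=.
  apply: eq_existsb => -[x b] /=; case xF: ((x, b) \in F j') => //=.
  case Xx: (X x) => //=; rewrite a_guess //.
  have := sub x; rewrite Xx andbT => /implyP; apply.
  by rewrite /appears; case: b xF => ->; rewrite ?orbT.
case: (boolP (satisfied_on X a j')) => // unsat'; case: nsub => x.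
have Uj' : #|U j'| <= #|U j| by apply: jmax; rewrite /= j'B inE j'B.
apply/implyP=> /andP[xF Xx]; have xU := UX j'B xF Xx.
case: (U_chain jB j'B) => [sub|/subsetP->//].
by have /eqP -> : U j == U j' by rewrite eqEcard sub Uj'.
Qed.

(** One set is [B] itself; each of the at most [m] choices of [j] contributes at most [2 ^ k] sets,
    one for each subset of [U j :\: V j]. *)
Lemma chain_bound :
  #|[set [set j in B | satisfied_on X a j] | a : {ffun 'I_n -> bool}]|
    <= (m * 2 ^ k).+1.
Proof.
pose fam j := [set guessed j T | T in powerset (U j :\: V j)].
have sub : [set [set j in B | satisfied_on X a j] | a : {ffun 'I_n -> bool}]
    \subset B |: \bigcup_(j in B) fam j.
  apply/subsetP=> _ /imsetP[a _ ->]; rewrite !inE.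
  case: (chain_cover a) => [->|[j jB [T TP ->]]]; first by rewrite eqxx.
  by apply/orP; right; apply/bigcupP; exists j => //; apply: imset_f.
apply: leq_trans (subset_leq_card sub) _; rewrite cardsU1.
rewrite -addn1 addnC leq_add ?leq_b1 //.
have cov : #|\bigcup_(j in B) fam j| <= \sum_(j in B) 2 ^ k.
  apply: (big_ind2 (fun (Y : {set {set 'I_m}}) y => #|Y| <= y)) => [|Y1 y1 Y2 y2 H1 H2|j jB].
  - by rewrite cards0.
  - by rewrite (leq_trans (leq_card_setU _ _)) ?leq_add.
  - rewrite (leq_trans (leq_imset_card _ _)) // card_powerset.
    by rewrite leq_exp2l ?Uk.
apply: leq_trans cov _; rewrite sum_nat_const leq_mul2r.
by rewrite -[X in _ <= X]card_ord max_card orbT.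
Qed.

End ChainBound.

(** * Effect of one item on the satisfied later clauses *)

Section Step.

Variables (n m : nat) (F : cnf n m).
Implicit Types (Z : {set 'I_m}) (a : {ffun 'I_n -> bool}) (u : 'I_n + 'I_m).

Definition literal_in (x : nat) (b : bool) (j : 'I_m) :=
  [exists l : 'I_n * bool, [&& l \in F j, l.1 == x :> nat & l.2 == b]].

(* The item coded by [it] leaves the later items: a clause is removed from [Z];
   a variable with value [b] adds the active clauses that it satisfies (no
   literal has the code of a clause, so that a clause adds nothing). *)
Definition step (act : pred 'I_m) (it : nat) (b : bool) Z : {set 'I_m} :=
  [set j | if j \in Z then it != n + j else act j && literal_in it b j].

Lemma literal_in_clause (c : 'I_m) b j : literal_in (n + c) b j = false.
Proof.
apply/existsP=> -[l /and3P[_ /eqP El _]].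
by have := ltn_ord l.1; rewrite El; lia.
Qed.

Lemma literal_inE (x : 'I_n) b j : literal_in x b j = ((x, b) \in F j).
Proof.
apply/existsP/idP => [[[y c] /and3P[/= yc /eqP/val_inj <- /eqP <-]] //|xb].
by exists (x, b); rewrite xb !eqxx.
Qed.

Lemma step_var act (x : 'I_n) b Z :
  step act x b Z = Z :|: [set j | act j && ((x, b) \in F j)].
Proof.
apply/setP=> j; rewrite !inE literal_inE; case: (j \in Z) => //=.
by have := ltn_ord x; lia.
Qed.

Lemma step_clause act (c : 'I_m) b Z : step act (n + c) b Z = Z :\ c.
Proof.
apply/setP=> j; rewrite !inE literal_in_clause andbF eqn_add2l.
by rewrite val_eqE eq_sym; case: (j \in Z); rewrite ?andbT ?andbF.
Qed.

Variable pos : 'I_n + 'I_m -> nat.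
Hypothesis pos_inj : injective pos.

Definition satisfied_before i a j := satisfied_on F (fun x => pos (inl x) < i) a j.

Definition later_satisfied i a : {set 'I_m} :=
  [set j in [set j | i <= pos (inr j)] | satisfied_before i a j].

Lemma satisfied_beforeS (x : 'I_n) a j :
  satisfied_before (pos (inl x)).+1 a j =
  satisfied_before (pos (inl x)) a j || ((x, a x) \in F j).
Proof.
apply/existsP/orP => [[[y b] /= /and3P[yF yx /eqP ay]]|[/existsP[[y b] /=]|xF]].
- move: yx; rewrite ltnS leq_eqVlt => /orP[/eqP/pos_inj[yx]|yx].
    by right; rewrite -yx ay.
  by left; apply/existsP; exists (y, b); rewrite /= yF yx ay eqxx.
- move=> /and3P[yF yx /eqP ay]; exists (y, b).
  by rewrite /= yF ay eqxx ltnS ltnW.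
- by exists (x, a x); rewrite /= xF ltnSn eqxx.
Qed.

Lemma satisfied_beforeS_clause (c : 'I_m) a j :
  satisfied_before (pos (inr c)).+1 a j = satisfied_before (pos (inr c)) a j.
Proof.
apply: eq_existsb => -[y b] /=; rewrite ltnS leq_eqVlt.
by case: eqP => // /pos_inj.
Qed.

Lemma eq_satisfied_before i a a' j :
  (forall x, pos (inl x) < i -> a x = a' x) ->
  satisfied_before i a j = satisfied_before i a' j.
Proof.
move=> aa'; apply: eq_existsb => -[y b] /=.
by case: (boolP (pos (inl y) < i)) => [/aa' ->|]; rewrite ?andbF.
Qed.

(** The assignment enters only through the previous set and the value [b], so that these sets behave
    as states of an automaton. For a clause, [b] is free. *)
Lemma later_satisfied_step u a b :
  (forall x, u = inl x -> b = a x) ->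
  later_satisfied (pos u).+1 a =
  step (fun j => pos u < pos (inr j)) (code_item u) b (later_satisfied (pos u) a).
Proof.
case: u => [x|c] /= ub.
  rewrite (ub x erefl) step_var; apply/setP=> j; rewrite !inE satisfied_beforeS.
  rewrite [pos (inl x) <= _]leq_eqVlt; case: eqP => [/pos_inj//|_] /=.
  by case: (_ < _).
rewrite step_clause; apply/setP=> j; rewrite !inE satisfied_beforeS_clause.
rewrite ltn_neqAle -andbA; congr (~~ _ && _).
by apply/eqP/eqP => [/pos_inj[->]|->].
Qed.

Lemma eq_later_satisfied i a a' :
  (forall x, pos (inl x) < i -> a x = a' x) ->
  later_satisfied i a = later_satisfied i a'.
Proof. by move=> aa'; apply/setP=> j; rewrite !inE (eq_satisfied_before j aa'). Qed.

Lemma later_satisfied0 a : later_satisfied 0 a = set0.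
Proof.
apply/setP=> j; rewrite !inE /=; apply/existsP=> -[[x b] /=].
by rewrite andbF.
Qed.

Lemma later_satisfied_top i a :
  (forall u, pos u < i) -> later_satisfied i a = set0.
Proof. by move=> le; apply/setP=> j; rewrite !inE leqNgt le. Qed.

End Step.

(** * Width of the cuts in a k-interval ordering *)

Section Bounds.

Variables (n m k : nat) (F : cnf n m) (lt : rel ('I_n + 'I_m)).
Variable pos : 'I_n + 'I_m -> nat.
Hypothesis lt_interval : forall j, #|[set x | exceptional F lt j x]| <= k.
Hypothesis pos_inj : injective pos.

(** [U j] is the final segment of the prefix variables that starts at the first variable of [j]. A
    member not in [j] lies between that variable and [j], which is the first case of [exceptional];
    final segments form a chain. *)
Lemma card_later_satisfied i :
  (forall u v, lt u v = (pos u < pos v)) ->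
  #|[set later_satisfied F pos i a | a : {ffun 'I_n -> bool}]| <= (m * 2 ^ k).+1.
Proof.
move=> ltE; pose U j := [set x | (pos (inl x) < i) &&
  [exists x', appears x' (F j) && (pos (inl x') <= pos (inl x))]].
apply: (chain_bound (U := U)).
- move=> j x _ xj xi; rewrite /U inE xi; apply/existsP; exists x.
  by rewrite xj leqnn.
- move=> j; rewrite inE => ij; apply: leq_trans (lt_interval j).
  apply/subset_leq_card/subsetP=> x; rewrite !inE /exceptional.
  move=> /and3P[xj xi /existsP[x' /andP[x'j x'x]]]; rewrite xj /=.
  apply/orP; left; apply/existsP; exists x'; rewrite x'j !ltE.
  rewrite (leq_trans xi ij) andbT ltn_neqAle x'x andbT.
  by apply: contraNneq xj => /pos_inj[<-].
- move=> j j' _ _; case: (boolP (U j \subset U j')) => [|/subsetPn[x]]; first by left.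
  rewrite !inE => /andP[xi /existsP[x0 /andP[x0j x0x]]].
  rewrite xi => /existsPn nj'; right; apply/subsetP=> y; rewrite !inE.
  move=> /andP[yi /existsP[x' /andP[x'j' x'y]]]; rewrite yi; apply/existsP.
  exists x0; rewrite x0j; have := nj' x'; rewrite x'j' -ltnNge => xx'.
  by rewrite (leq_trans x0x) // (leq_trans (ltnW xx')).
Qed.

(** Positions are those of the reversed order. [U j] consists of the variables beyond the cut that
    occur in some clause up to [j] in the original order: those not in [j] fall under the second
    case of [exceptional], and [U j] grows as [j] moves towards the cut. *)
Lemma card_later_satisfied_rev i :
  (forall u v, lt u v = (pos v < pos u)) ->
  #|[set later_satisfied F pos i a | a : {ffun 'I_n -> bool}]| <= (m * 2 ^ k).+1.
Proof.
move=> ltE; pose U j := [set x | (pos (inl x) < i) &&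
  [exists j', appears x (F j') && (pos (inr j) <= pos (inr j'))]].
apply: (chain_bound (U := U)).
- move=> j x _ xj xi; rewrite /U inE xi; apply/existsP; exists j.
  by rewrite xj leqnn.
- move=> j; rewrite inE => ij; apply: leq_trans (lt_interval j).
  apply/subset_leq_card/subsetP=> x; rewrite !inE /exceptional.
  move=> /and3P[xj xi /existsP[j' /andP[xj' jj']]]; rewrite xj /=.
  apply/orP; right; apply/existsP; exists j'; rewrite xj' !ltE.
  rewrite (leq_trans xi ij) andbT ltn_neqAle jj' andbT.
  by apply: contraNneq xj => /pos_inj[->].
- move=> j j' _ _; have sub j1 j2 : pos (inr j1) <= pos (inr j2) -> U j2 \subset U j1.
    move=> le; apply/subsetP=> x; rewrite !inE => /andP[-> /existsP[c /andP[xc cj]]].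
    by apply/existsP; exists c; rewrite xc (leq_trans le).
  by case/orP: (leq_total (pos (inr j)) (pos (inr j'))) => /sub; [right|left].
Qed.

End Bounds.

(** * Duplicate-free lists *)

Section AddNew.

Variable T : eqType.
Implicit Types (l r : seq T) (x : T).

(** Insertion at the end keeps the order in which the machine writes the sets, so that list and
    memory can be compared cell by cell. *)
Definition add_new l x := if x \in l then l else rcons l x.

Lemma add_new_uniq l x : uniq l -> uniq (add_new l x).
Proof. by rewrite /add_new; case: ifP => // xl; rewrite rcons_uniq xl. Qed.

Lemma mem_add_new l x y : (y \in add_new l x) = (y == x) || (y \in l).
Proof.
rewrite /add_new; case: ifP => xl; last by rewrite mem_rcons inE.
by case: eqP => // ->.
Qed.

Lemma foldl_add_new_uniq l r : uniq l -> uniq (foldl add_new l r).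
Proof. by elim: r l => //= x r IHr l /(add_new_uniq x)/IHr. Qed.

Lemma mem_foldl_add_new l r : foldl add_new l r =i l ++ r.
Proof.
elim: r l => [|x r IHr] l y /=; first by rewrite cats0.
by rewrite IHr !mem_cat mem_add_new inE orbA [(y == x) || _]orbC.
Qed.

End AddNew.

(** * Families of sets reached by the assignments *)

Section Families.

Variables (n m : nat) (F : cnf n m) (its : seq ('I_n + 'I_m)).
Hypothesis its_uniq : uniq its.
Hypothesis its_all : forall u, u \in its.

Implicit Types (Z S : {set 'I_m}) (a : {ffun 'I_n -> bool}) (u : 'I_n + 'I_m).

Let N := size its.

Lemma size_items : N = n + m.
Proof.
rewrite /N -(card_uniqP its_uniq).
by rewrite (eq_card (B := {: 'I_n + 'I_m})) ?card_sum ?card_ord //.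
Qed.

Definition pos u := index u its.
Definition rpos u := N.-1 - pos u.

Lemma pos_lt u : pos u < N. Proof. by rewrite index_mem. Qed.

Lemma pos_inj : injective pos.
Proof. by move=> u v /(congr1 (nth u its)); rewrite !nth_index. Qed.

Lemma rpos_inj : injective rpos.
Proof.
move=> u v; rewrite /rpos => uv; apply: pos_inj.
by have := pos_lt u; have := pos_lt v; lia.
Qed.

Lemma pos_surj i : i < N -> exists u, pos u = i.
Proof.
rewrite /N /pos; case: its its_uniq => [|u0 s] // us iN.
by exists (nth u0 (u0 :: s) i); rewrite index_uniq.
Qed.

(* The order is followed by its reverse, so that one pass lists the families of
   both: the one of the cut [i] is [fam i], and the one of the same cut in the
   reverse order is [fam (N + N - i)].  They meet at [fam N], which only contains
   the empty set. *)
Definition pcode i := nth 0 [seq code_item u | u <- its ++ rev its] i.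

(** In the second half the item has reverse position [i - N], and the clause comes after it when
    [i - N < N.-1 - pos (inr j)]; the additive form avoids truncated subtraction. *)
Definition pact i (j : 'I_m) :=
  if i < N then i < pos (inr j) else pos (inr j) + i.+1 < N + N.

Definition pstep i := step F (pact i) (pcode i).

Lemma pcode_pos u : pcode (pos u) = code_item u.
Proof.
have uN := pos_lt u.
rewrite /pcode (nth_map u) ?size_cat ?ltn_addr // nth_cat uN.
by rewrite nth_index.
Qed.

Lemma pcode_rev i : i < N -> pcode (N + N - i.+1) = pcode i.
Proof.
move=> /pos_surj[u <-]; rewrite pcode_pos; have uN := pos_lt u.
rewrite /pcode (nth_map u) ?size_cat ?size_rev; last by rewrite -/N; lia.
rewrite nth_cat -/N ifF; last by lia.
rewrite nth_rev -/N; last by lia.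
have -> : N - (N + N - (pos u).+1 - N).+1 = pos u by lia.
by rewrite nth_index.
Qed.

(** A clause item yields the same successor twice. Keeping both puts the successor of the set number
    [p] for the value [b] at place [2 p + b]; [add_new] drops the repetition from the next
    family. *)
Definition succs i (l : seq {set 'I_m}) :=
  flatten [seq [:: pstep i false Z; pstep i true Z] | Z <- l].

Fixpoint fam i : seq {set 'I_m} :=
  if i is i'.+1 then foldl (@add_new _) [::] (succs i' (fam i')) else [:: set0].

Lemma fam_uniq i : uniq (fam i).
Proof. by case: i => // i; apply: foldl_add_new_uniq. Qed.

Lemma mem_fam_succ i Z : reflect
  (exists2 Z0, Z0 \in fam i & exists b, Z = pstep i b Z0) (Z \in fam i.+1).
Proof.
rewrite /= mem_foldl_add_new /=; apply: (iffP flatten_mapP).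
- move=> [Z0 Z0i]; rewrite !inE => ZE; exists Z0 => //.
  by case/orP: ZE => /eqP ->; [exists false | exists true].
- move=> [Z0 Z0i [b ->]]; exists Z0; rewrite // !inE.
  by case: b; rewrite eqxx ?orbT.
Qed.

Lemma fam_step i b Z : Z \in fam i -> pstep i b Z \in fam i.+1.
Proof. by move=> Zi; apply/mem_fam_succ; exists Z => //; exists b. Qed.

(** The argument [x] is the code of an item: on the code of a clause, [assign] changes nothing and
    [bit] is false, so that items of both kinds are treated alike. *)
Definition assign a x b : {ffun 'I_n -> bool} :=
  [ffun y : 'I_n => if val y == x then b else a y].

Definition bit a x := [exists y : 'I_n, (val y == x) && a y].

Lemma bitE a (x : 'I_n) : bit a x = a x.
Proof.
apply/existsP/idP => [[y /andP[/eqP/val_inj -> //]]|ax].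
by exists x; rewrite eqxx.
Qed.

Lemma bit_item a u x : u = inl x -> bit a (code_item u) = a x.
Proof. by move=> ->; rewrite bitE. Qed.

(** The offset [i0] is 0 for the order and [N] for its reverse. Both branches at an item are
    realized by assignments, because changing the value of the current variable does not affect the
    set before it. *)
Lemma mem_fam_later i0 (pos' : 'I_n + 'I_m -> nat) :
  injective pos' -> fam i0 =i [:: set0] ->
  (forall i, i < N -> exists u, [/\ pos' u = i, pcode (i0 + i) = code_item u &
     pact (i0 + i) =1 fun j => i < pos' (inr j)]) ->
  forall i, i <= N ->
  fam (i0 + i) =i [set later_satisfied F pos' i a | a : {ffun 'I_n -> bool}].
Proof.
move=> inj fam0 items; elim=> [|i IHi] iN Z.
  rewrite addn0 fam0 inE; apply/eqP/imsetP => [->|[a _ ->]].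
    by exists [ffun=> false]; rewrite ?later_satisfied0.
  by rewrite later_satisfied0.
have [u [ui codeE actE]] := items i iN.
have stepE b Y : pstep (i0 + i) b Y =
    step F (fun j => pos' u < pos' (inr j)) (code_item u) b Y.
  by apply/setP=> j; rewrite !inE codeE actE ui.
rewrite addnS; apply/mem_fam_succ/imsetP => [[Z0]|[a _ ->]].
- rewrite IHi ?(ltnW iN) // => /imsetP[a _ ->] [b ->].
  exists (assign a (code_item u) b) => //; rewrite stepE -ui.
  rewrite (later_satisfied_step F inj (u := u) (b := b)); last first.
    by move=> x ->; rewrite ffunE eqxx.
  congr step; apply: eq_later_satisfied => x xu; rewrite ffunE.
  case: eqP => // E; case: u xu E {ui codeE stepE} => [y|c] /=.
    by move=> + /val_inj E; rewrite E ltnn.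
  by have := ltn_ord x; lia.
- exists (later_satisfied F pos' i a); first by rewrite IHi ?(ltnW iN) ?imset_f.
  exists (bit a (code_item u)); rewrite stepE -ui.
  by apply: later_satisfied_step => // x xu; rewrite (bit_item _ xu).
Qed.

Lemma mem_fam i : i <= N ->
  fam i =i [set later_satisfied F pos i a | a : {ffun 'I_n -> bool}].
Proof.
apply: (@mem_fam_later 0) => //; first exact: pos_inj.
move=> i' /[dup] i'N /pos_surj[u ui]; exists u; split=> //.
  by rewrite -ui pcode_pos.
by move=> j; rewrite /pact i'N.
Qed.

Lemma fam_full : fam N =i [:: set0].
Proof.
move=> Z; rewrite mem_fam // inE.
have E a : later_satisfied F pos N a = set0 by apply/later_satisfied_top/pos_lt.
apply/imsetP/eqP => [[a _ ->]|->]; first exact: E.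
by exists [ffun=> false]; rewrite ?E.
Qed.

Lemma mem_fam_rev i : i <= N ->
  fam (N + i) =i [set later_satisfied F rpos i a | a : {ffun 'I_n -> bool}].
Proof.
apply: mem_fam_later; [exact: rpos_inj | exact: fam_full |].
move=> i' i'N; have [u ui] : exists u, pos u = N.-1 - i' by apply: pos_surj; lia.
exists u; split.
- by rewrite /rpos ui; lia.
- rewrite -pcode_pos ui -(@pcode_rev (N.-1 - i')); last by lia.
  by congr pcode; lia.
- move=> j; rewrite /pact /rpos; have := pos_lt (inr j).
  by case: ifP; lia.
Qed.

Lemma size_fam k (lt : rel ('I_n + 'I_m)) i :
  (forall j, #|[set x | exceptional F lt j x]| <= k) ->
  (forall u v, lt u v = (pos u < pos v)) ->
  i <= N + N -> size (fam i) <= (m * 2 ^ k).+1.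
Proof.
move=> ltk ltE iN; have [iN'|iN'] := leqP i N.
  rewrite -(card_uniqP (fam_uniq i)) (eq_card (mem_fam iN')).
  by apply: card_later_satisfied; eauto; apply: pos_inj.
rewrite -(card_uniqP (fam_uniq i)) -(subnKC (ltnW iN')).
rewrite (eq_card (mem_fam_rev _)); last by lia.
apply: card_later_satisfied_rev; [exact: ltk | exact: rpos_inj |] => u v.
by rewrite ltE /rpos; have := pos_lt u; have := pos_lt v; lia.
Qed.

Lemma fam_later i S j : i <= N -> S \in fam i -> j \in S -> i <= pos (inr j).
Proof. by move=> iN; rewrite mem_fam // => /imsetP[a _ ->]; rewrite !inE => /andP[]. Qed.

Lemma fam_earlier i S j :
  i <= N -> S \in fam (N + N - i) -> j \in S -> pos (inr j) < i.
Proof.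
move=> iN; have -> : N + N - i = N + (N - i) by lia.
rewrite mem_fam_rev ?leq_subr // => /imsetP[a _ ->]; rewrite !inE => /andP[+ _].
rewrite /rpos; set p := pos _; have : p < N by apply: pos_lt.
by lia.
Qed.

(** Going back from the cut [i.+1] to the cut [i] crosses the entry [N + N - i.+1] of the doubled
    list, which is the second copy of the item [i]. *)
Lemma fam_step_rev i b S :
  i < N -> S \in fam (N + N - i.+1) -> pstep (N + N - i.+1) b S \in fam (N + N - i).
Proof.
move=> iN Si; have -> : N + N - i = (N + N - i.+1).+1 by lia.
exact: fam_step.
Qed.

(** * Recurrences across one item *)

Definition later := later_satisfied F pos.

Lemma later_fam i a : i <= N -> later i a \in fam i.
Proof. by move=> iN; rewrite mem_fam // imset_f. Qed.

Lemma later_step i a : i < N -> later i.+1 a = pstep i (bit a (pcode i)) (later i a).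
Proof.
move=> iN; have [u ui] := pos_surj iN.
rewrite -ui /later (later_satisfied_step F pos_inj (u := u) (b := bit a (pcode i))).
  by apply/setP=> j; rewrite !inE ui -ui pcode_pos /pact ui iN.
by move=> x xu; rewrite -ui pcode_pos (bit_item _ xu).
Qed.

(** [S] is a promise: the clauses of the prefix that the variables of the suffix are going to
    satisfy. *)
Definition done i a S : {set 'I_m} :=
  [set j | (pos (inr j) < i) && ((j \in S) || satisfied_before F pos i a j)].

(** Variables are never an obstacle. A clause is satisfied by the variables before it if it is in
    [S], and by those after it if it is in [S']. *)
Definition ok i S S' := (pcode i < n) ||
  [exists c : 'I_m, (pcode i == n + c) && ((c \in S) || (c \in S'))].

Lemma ok_clause i S S' (c : 'I_m) :
  pcode i = n + c -> ok i S S' = (c \in S) || (c \in S').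
Proof.
move=> ic; rewrite /ok ic ltnNge leq_addr /=; apply/existsP/idP.
  by move=> [d /andP[/eqP/addnI/val_inj <-]].
by move=> cSS'; exists c; rewrite eqxx.
Qed.

(** Read from right to left, the variable passes from the promising side to the assigned one: the
    clauses that it satisfies leave the promise but stay satisfied. *)
Lemma done_var i a S : i < N -> pcode i < n ->
  done i.+1 a S = done i a (pstep (N + N - i.+1) (bit a (pcode i)) S).
Proof.
move=> iN; have [[x|c] ui] := pos_surj iN; last first.
  by rewrite -ui pcode_pos /= ltnNge leq_addr.
move=> _; apply/setP=> j; rewrite !inE pcode_rev // -ui pcode_pos /= bitE.
rewrite satisfied_beforeS; last exact: pos_inj.
rewrite literal_inE ltnS leq_eqVlt; case: eqP => [/pos_inj//|_] /=.
case E: (_ < _) => //=.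
have -> : pact (N + N - (pos (inl x)).+1) j.
  by rewrite /pact ifF; have := pos_lt (inr j); have := pos_lt (inl x); lia.
case: (j \in S) => //=; last by rewrite orbC.
by have := ltn_ord x; case: eqP => //=; lia.
Qed.

Lemma done_clause i a b S (c : 'I_m) : i < N -> pcode i = n + c ->
  done i.+1 a S = done i a (pstep (N + N - i.+1) b S)
    :|: [set j | (j == c) && ok i (later i a) S].
Proof.
move=> iN; have [[x|c'] ui] := pos_surj iN.
  by rewrite -ui pcode_pos /= => xc; have := ltn_ord x; rewrite xc; lia.
move=> ic; rewrite (ok_clause _ _ ic); move: ic.
rewrite -{1}ui pcode_pos /= => /addnI/val_inj ?; subst c'.
rewrite /pstep pcode_rev // -ui pcode_pos /= step_clause.
apply/setP=> j; rewrite !inE satisfied_beforeS_clause; last exact: pos_inj.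
rewrite ltnS leq_eqVlt leqnn /=; case: eqP => [/pos_inj[->]|E] /=.
  by rewrite ltnn eqxx /= orbC.
have -> : (j == c) = false by apply/eqP => jc; case: E; rewrite jc.
by rewrite orbF.
Qed.

(** A clause has a single branch; two would count every assignment twice. *)
Definition branches i := if pcode i < n then [:: false; true] else [:: false].

Lemma bit_branches a i : bit a (pcode i) \in branches i.
Proof.
rewrite /branches; case: ifP => in_; first by case: bit.
rewrite inE; apply/eqP/existsP => -[y /andP[/eqP yi _]].
by have := ltn_ord y; rewrite yi in_.
Qed.

Lemma bit_assign a i b : b \in branches i -> bit (assign a (pcode i) b) (pcode i) = b.
Proof.
rewrite /branches; case: ifP => in_.
  by rewrite (bitE _ (Ordinal in_)) ffunE eqxx.
rewrite inE => /eqP ->; apply/existsP => -[y /andP[/eqP yi _]].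
by have := ltn_ord y; rewrite yi in_.
Qed.

Lemma assign_before a i b x :
  i < N -> pos (inl x) < i -> assign a (pcode i) b x = a x.
Proof.
move=> iN xi; rewrite ffunE; case: eqP => // E.
have [[y|c] ui] := pos_surj iN; move: E; rewrite -ui pcode_pos /=.
  by move=> /val_inj xy; move: xi; rewrite xy ui ltnn.
by have := ltn_ord x; lia.
Qed.

Lemma later_assign a i b : i < N -> later i (assign a (pcode i) b) = later i a.
Proof. by move=> iN; apply: eq_later_satisfied => x; apply: assign_before. Qed.

Lemma done_assign a i b S : i < N -> done i (assign a (pcode i) b) S = done i a S.
Proof.
move=> iN; apply/setP=> j; rewrite !inE; congr (_ && (_ || _)).
by apply: eq_satisfied_before => x; apply: assign_before.
Qed.

Lemma clause_or_var i : i < N -> (pcode i < n) + {c : 'I_m | pcode i = n + c}.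
Proof.
move=> iN; case: (ltnP (pcode i) n) => in_; first by left.
right; have im : pcode i - n < m.
  have [[x|c] ui] := pos_surj iN; move: in_; rewrite -ui pcode_pos /=.
    by rewrite leqNgt ltn_ord.
  by rewrite addKn.
by exists (Ordinal im) => /=; rewrite subnKC.
Qed.

Lemma done_top a : done N a set0 = [set j | sat_clause a (F j)].
Proof.
apply/setP=> j; rewrite !inE pos_lt /=; apply: eq_existsb => -[x b] /=.
by rewrite pos_lt.
Qed.

(** An assignment of the prefix variables is represented by its extension by false, so that a sum
    over total assignments counts it once. *)
Definition unset_from i a := [forall x : 'I_n, (i <= pos (inl x)) ==> ~~ a x].

Definition earlier_done i a S := [set j | pos (inr j) < i] \subset done i a S.

Definition count i S S' :=
  \sum_(a | unset_from i a) ((later i a == S) && earlier_done i a S').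

Lemma sum_unset_from i (G : {ffun 'I_n -> bool} -> nat) : i < N ->
  \sum_(a | unset_from i.+1 a) G a =
  \sum_(a | unset_from i a) \sum_(b <- branches i) G (assign a (pcode i) b).
Proof.
move=> iN; have [u ui] := pos_surj iN.
have codeE : pcode i = code_item u by rewrite -ui pcode_pos.
rewrite /branches codeE; case: u ui codeE => [x|c] /= ui _; last first.
  rewrite ltnNge leq_addr /=; apply: eq_big => a.
    apply: eq_forallb => x; rewrite -ui [pos (inr c) <= _]leq_eqVlt.
    by case: eqP => // /pos_inj.
  move=> _; rewrite big_seq1; congr G; apply/ffunP=> x; rewrite ffunE.
  by case: eqP => // E; have := ltn_ord x; rewrite [x : nat]E; lia.
rewrite ltn_ord (bigID (fun a : {ffun 'I_n -> bool} => a x)) /= addnC.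
under [RHS]eq_bigr do rewrite big_cons big_seq1.
rewrite big_split /=.
have unsetP a : unset_from i a = unset_from i.+1 a && ~~ a x.
  apply/forallP/andP => [H|[/forallP H ax] y].
    split; last by have := H x; rewrite ui leqnn.
    by apply/forallP=> y; apply/implyP=> /ltnW; apply/implyP/H.
  rewrite leq_eqVlt; case: eqP => [|_]; last exact: H.
  by rewrite -ui => /pos_inj[<-].
have assignE a b y : assign a x b y = if y == x then b else a y by rewrite ffunE.
congr (_ + _).
- apply: eq_big => a; first by rewrite unsetP.
  move=> /andP[_ /negbTE ax]; congr G; apply/ffunP=> y; rewrite assignE.
  by case: eqP => // ->.
(* Assignments with [x] true correspond to those unset from [i]: set [x] to true in one direction,
   to false in the other. *)
- rewrite [LHS](reindex_onto (fun a => assign a x true) (fun a => assign a x false)) /=.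
    apply: eq_big => // a; rewrite assignE eqxx andbT unsetP.
    rewrite [LHS]andbC; have -> : unset_from i.+1 (assign a x true) = unset_from i.+1 a.
      apply: eq_forallb => y; rewrite assignE; case: eqP => // ->.
      by rewrite ui ltnn.
    case ax: (a x) => /=.
      rewrite andbF; apply/andP => -[/eqP/ffunP/(_ x)].
      by rewrite assignE eqxx ax.
    rewrite andbT; case: (unset_from _ _); rewrite ?andbF // andbT.
    by apply/eqP/ffunP=> y; rewrite !assignE; case: eqP => // ->.
  move=> a /andP[_ ax]; apply/ffunP=> y; rewrite !assignE.
  by case: eqP => // ->.
Qed.

Lemma earlier_done_rec i a S : i < N ->
  earlier_done i.+1 a S =
  earlier_done i a (pstep (N + N - i.+1) (bit a (pcode i)) S) && ok i (later i a) S.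
Proof.
move=> iN; rewrite /earlier_done; case: (clause_or_var iN) => [in_|[c ic]].
  rewrite (done_var _ _ iN) // /ok in_ andbT.
  suff -> : [set j : 'I_m | pos (inr j) < i.+1] = [set j | pos (inr j) < i] by [].
  apply/setP=> j; rewrite !inE ltnS leq_eqVlt; case: eqP => // ji.
  by move: in_; rewrite -ji pcode_pos /= ltnNge leq_addr.
rewrite (done_clause _ (bit a (pcode i)) _ iN ic); set D := done _ _ _; set o := ok _ _ _.
have pc : pos (inr c) = i.
  have [[x|c'] ui] := pos_surj iN; move: ic; rewrite -ui pcode_pos /=.
    by have := ltn_ord x; lia.
  by move=> /addnI/val_inj ->.
(* [c] stands exactly at the cut [i], so only the added singleton can contain it; this separates the
   condition on [c] from the one on the earlier clauses. *)
have cD : c \notin D by rewrite inE pc ltnn.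
apply/subsetP/andP => [H|[/subsetP H oT] j].
  split.
    apply/subsetP=> j; rewrite inE => ji; have := H j; rewrite !inE ltnS (ltnW ji).
    move=> /(_ isT); case: (j =P c) => [jc|_] /=; last by rewrite orbF.
    by move: ji; rewrite jc pc ltnn.
  by have := H c; rewrite !inE pc leqnn eqxx ltnn /=; apply.
rewrite inE ltnS leq_eqVlt !inE oT andbT => /orP[|ji].
  by rewrite -pc => /eqP/pos_inj[->]; rewrite eqxx orbT.
by have := H j; rewrite !inE => ->.
Qed.

(** A Kronecker sum over a duplicate-free list. It inserts a sum over a family where an assignment
    has a single state, and extracts the column of a given promise from a sum over events. *)
Lemma sum_uniq_eq (T : eqType) (l : seq T) (x : T) (G : T -> nat) :
  uniq l -> x \in l -> \sum_(y <- l) (x == y) * G y = G x.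
Proof.
move=> lu xl; rewrite (bigD1_seq x) //= eqxx mul1n big1 ?addn0 // => y.
by rewrite eq_sym => /negbTE ->.
Qed.

(** An assignment of the longer prefix arises from exactly one shorter one and one branch, and the
    shorter one has exactly one state in the family; promises travel the other way, through [pstep]
    at [N + N - i.+1]. *)
Lemma count_rec i Sn S' : i < N ->
  count i.+1 Sn S' = \sum_(S <- fam i) \sum_(b <- branches i)
    ((pstep i b S == Sn) && ok i S S') * count i S (pstep (N + N - i.+1) b S').
Proof.
move=> iN; rewrite /count sum_unset_from //; set r := N + N - i.+1.
transitivity (\sum_(a | unset_from i a) \sum_(S <- fam i) \sum_(b <- branches i)
  ((pstep i b S == Sn) && ok i S S')
    * ((later i a == S) && earlier_done i a (pstep r b S'))); last first.
  rewrite exchange_big; apply: eq_bigr => S _.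
  by rewrite exchange_big; apply: eq_bigr => b _; rewrite big_distrr.
apply: eq_bigr => a _; rewrite exchange_big /=; apply: eq_big_seq => b bi.
have -> : (later i.+1 (assign a (pcode i) b) == Sn)
    && earlier_done i.+1 (assign a (pcode i) b) S' =
    [&& pstep i b (later i a) == Sn, ok i (later i a) S'
      & earlier_done i a (pstep r b S')].
  rewrite later_step // earlier_done_rec // bit_assign // later_assign //.
  by rewrite /earlier_done done_assign // [X in _ && X]andbC.
rewrite andbA -(sum_uniq_eq
    (fun S => ((pstep i b S == Sn) && ok i S S') && earlier_done i a (pstep r b S') : nat)
    (fam_uniq i) (later_fam _ (ltnW iN))).
by apply: eq_bigr => S _; rewrite !mulnb andbCA.
Qed.

Lemma count0 : count 0 set0 set0 = 1.
Proof.
rewrite /count (bigD1 [ffun=> false]) /=; last by apply/forallP=> x; rewrite ffunE.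
rewrite big1 => [|a /andP[/forallP a0 /eqP[]]]; last first.
  by apply/ffunP=> x; rewrite ffunE; apply/negbTE/a0.
rewrite addn0 /later later_satisfied0 eqxx /=.
by have -> // : earlier_done 0 [ffun=> false] set0; apply/subsetP=> j; rewrite inE.
Qed.

Lemma count_top : count N set0 set0 = count_sat F.
Proof.
rewrite /count /count_sat -sum1_card [RHS]big_mkcond /=.
apply: eq_big => a.
  by apply/forallP=> x; rewrite leqNgt pos_lt.
move=> _; rewrite inE /later later_satisfied_top; last exact: pos_lt.
rewrite eqxx /= /earlier_done done_top; congr nat_of_bool.
apply/subsetP/forallP => [sub j|H j _]; last by rewrite inE.
by have := sub j; rewrite !inE pos_lt; apply.
Qed.

(** * Weight of the satisfied or promised clauses *)

Variables (R : realDomainType) (W : nat -> R).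

Definition value i a S : R := (\sum_(j in done i a S) W j)%R.

Definition gain i S S' : R :=
  if (n <= pcode i) && ok i S S' then W (pcode i - n) else 0%R.

Lemma value_rec i a S : i < N ->
  value i.+1 a S =
  (value i a (pstep (N + N - i.+1) (bit a (pcode i)) S) + gain i (later i a) S)%R.
Proof.
move=> iN; rewrite /value /gain; case: (clause_or_var iN) => [in_|[c ic]].
  by rewrite (done_var _ _ iN) // leqNgt in_ addr0.
rewrite (done_clause _ (bit a (pcode i)) _ iN ic) ic leq_addr /= addKn.
set D := done _ _ _; case: (ok _ _ _); last first.
  by rewrite addr0; apply: eq_bigl => j; rewrite !inE andbF orbF.
have pc : pos (inr c) = i.
  have [[x|c'] ui] := pos_surj iN; move: ic; rewrite -ui pcode_pos /=.
    by have := ltn_ord x; lia.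
  by move=> /addnI/val_inj ->.
rewrite (bigD1 c) /=; last by rewrite !inE eqxx orbT.
rewrite addrC; congr (_ + _)%R; apply: eq_bigl => j.
rewrite !inE andbT; case: (j =P c) => [->|_]; last by rewrite orbF andbT.
by rewrite pc ltnn.
Qed.

Lemma value0 a S : value 0 a S = 0%R.
Proof. by rewrite /value big1 // => j; rewrite inE. Qed.

Lemma value_top a (w : 'I_m -> R) :
  (forall j : 'I_m, W j = w j) -> value N a set0 = sat_weight F w a.
Proof.
by move=> Ww; rewrite /value done_top; apply: eq_big => j; rewrite ?inE.
Qed.

Lemma value_assign a i b S : i < N -> value i (assign a (pcode i) b) S = value i a S.
Proof. by move=> iN; rewrite /value done_assign. Qed.

End Families.

(** * Dynamic programming tables *)

Section Table.

Variables (n m : nat) (F : cnf n m) (its : seq ('I_n + 'I_m)).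
Variables (R : realDomainType) (W : nat -> R).
Hypothesis its_uniq : uniq its.
Hypothesis its_all : forall u, u \in its.

Let N := size its.

Implicit Types (S : {set 'I_m}) (a : {ffun 'I_n -> bool}).

(* The table of the cut [i] lies at the addresses [base i + z] with [z < 2 ^ m]. *)
Definition base i := i * 2 ^ m.
Definition addr i S S' := base i + (bitmask S + bitmask S').

Let left_sets i := fam F its i.
Let right_sets i := fam F its (N + N - i).

Lemma cut_disjoint i S S' : i <= N ->
  S \in left_sets i -> S' \in right_sets i -> [disjoint S & S'].
Proof.
move=> iN Si S'i; apply/pred0P=> j /=; apply/andP=> -[jS jS'].
have := fam_later its_uniq its_all iN Si jS.
by have := fam_earlier its_uniq its_all iN S'i jS'; lia.
Qed.

Lemma baseS i : base i.+1 = base i + 2 ^ m.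
Proof. by rewrite /base mulSn addnC. Qed.

Lemma addr_lt i S S' : i <= N ->
  S \in left_sets i -> S' \in right_sets i -> addr i S S' < base i.+1.
Proof.
move=> iN Si S'i; rewrite baseS ltn_add2l -bitmaskU ?bitmask_lt //.
exact: cut_disjoint iN Si S'i.
Qed.

(** Masks of disjoint sets add up to the mask of the union, which determines the union; the position
    of each clause relative to the cut then tells which of the two sets it belongs to. *)
Lemma addr_inj i S S' T T' : i <= N ->
  S \in left_sets i -> S' \in right_sets i ->
  T \in left_sets i -> T' \in right_sets i ->
  addr i S S' = addr i T T' -> S = T /\ S' = T'.
Proof.
move=> iN Si S'i Ti T'i /addnI; rewrite -!bitmaskU ?(@cut_disjoint i) //.
move=> /bitmask_inj/setP E.
have late X j : X \in left_sets i -> pos its (inr j) < i -> (j \in X) = false.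
  move=> Xi ji; apply/negP=> /(fam_later its_uniq its_all iN Xi).
  by rewrite leqNgt ji.
have early X j : X \in right_sets i -> i <= pos its (inr j) -> (j \in X) = false.
  move=> Xi ji; apply/negP=> /(fam_earlier its_uniq its_all iN Xi).
  by rewrite ltnNge ji.
split; apply/setP=> j; have := E j; rewrite !inE; case: (leqP i (pos its (inr j))) => ij.
- by rewrite (early S') // (early T') // !orbF.
- by rewrite (late S) // (late T).
- by rewrite (early S') // (early T').
- by rewrite (late S) // (late T).
Qed.

(* An event [(S, S', b)] extends the assignments that leave the later clauses
   [S] satisfied by giving the value [b] to the item [i]; the set [S'] of earlier
   clauses to be satisfied later is the one after this extension. *)
Definition event : Type := ({set 'I_m} * {set 'I_m} * bool)%type.

Definition source_addr i (e : event) :=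
  addr i e.1.1 (pstep F its (N + N - i.+1) e.2 e.1.2).
Definition target_addr i (e : event) := addr i.+1 (pstep F its i e.2 e.1.1) e.1.2.

Definition pair_events i S S' := [seq (S, S', b) | b <- branches its i].
Definition row_events i S (l : seq {set 'I_m}) := flatten [seq pair_events i S S' | S' <- l].
Definition events i (l : seq {set 'I_m}) :=
  flatten [seq row_events i X (right_sets i.+1) | X <- l].

Lemma eventsP i S S' b : reflect
  [/\ S \in left_sets i, S' \in right_sets i.+1 & b \in branches its i]
  ((S, S', b) \in events i (left_sets i)).
Proof.
apply: (iffP flatten_mapP) => [[T Ti /flatten_mapP[T' T'i /mapP[c ci]]]|[Si S'i bi]].
  by case=> -> -> ->.
exists S => //; apply/flatten_mapP; exists S' => //.
exact: (map_f (fun c => (S, S', c)) bi).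
Qed.

Lemma right_step i b S : i < N ->
  S \in right_sets i.+1 -> pstep F its (N + N - i.+1) b S \in right_sets i.
Proof. by move=> iN; apply: fam_step_rev. Qed.

Lemma source_lt i e : i < N -> e \in events i (left_sets i) -> source_addr i e < base i.+1.
Proof.
case: e => [[S S'] b] iN /eventsP[Si S'i _].
by apply: addr_lt (ltnW iN) Si (right_step b iN S'i).
Qed.

Lemma target_ge i e : base i.+1 <= target_addr i e.
Proof. exact: leq_addr. Qed.

Lemma target_lt i e : i < N -> e \in events i (left_sets i) -> target_addr i e < base i.+2.
Proof.
case: e => [[S S'] b] iN /eventsP[Si S'i _].
by apply: addr_lt iN (fam_step b Si) S'i.
Qed.

Definition event_ok i (e : event) := ok its i e.1.1 e.1.2.
Definition event_gain i (e : event) : R := gain its W i e.1.1 e.1.2.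

(** The flag [reached_of] is kept apart from [best_of] because weights may be negative: a stored 0
    cannot stand for a missing candidate. *)
Record memo := Memo
  { counts_of : nat -> nat; reached_of : nat -> nat; pred_of : nat -> nat;
    bit_of : nat -> nat; best_of : nat -> R }.

Implicit Types t : memo.

(** The state after the events [es] of the item [i], started from [t0]. Counts, pointers, bits and
    weights below [base i.+1] belong to older cuts and are frozen, so sources can still be read as
    in [t0]. *)
Record processed i t0 (es : seq event) t : Prop := Processed {
  proc_counts : forall y, counts_of t y = if y < base i.+1 then counts_of t0 y
    else \sum_(e <- es) (target_addr i e == y) * (event_ok i e * counts_of t0 (source_addr i e));
  proc_pred : forall y, y < base i.+1 -> pred_of t y = pred_of t0 y;
  proc_bit : forall y, y < base i.+1 -> bit_of t y = bit_of t0 y;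
  proc_best : forall y, y < base i.+1 -> best_of t y = best_of t0 y;
  proc_pred_le : forall y, pred_of t y <= y;
  proc_reached : forall e, e \in es -> 0 < reached_of t (target_addr i e);
  proc_best_ge : forall e, e \in es ->
    (best_of t0 (source_addr i e) + event_gain i e <= best_of t (target_addr i e))%R;
  proc_best_eq : forall y, base i.+1 <= y -> 0 < reached_of t y -> exists2 e, e \in es &
    [/\ target_addr i e = y, pred_of t y = source_addr i e, bit_of t y = e.2
      & best_of t y = (best_of t0 (source_addr i e) + event_gain i e)%R] }.

Fixpoint trace t i y : {ffun 'I_n -> bool} :=
  if i is i'.+1 then assign (trace t i' (pred_of t y)) (pcode its i') (0 < bit_of t y)
  else [ffun=> false].

(** Pointers never increase, so a trace that starts below [b] stays in the part where both memories
    agree. *)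
Lemma eq_trace t t' b i y :
  (forall z, z < b -> pred_of t' z = pred_of t z) ->
  (forall z, z < b -> bit_of t' z = bit_of t z) ->
  (forall z, pred_of t z <= z) -> y < b -> trace t' i y = trace t i y.
Proof.
move=> P B le; elim: i y => //= i IHi y yb; rewrite P // B // IHi //.
exact: leq_ltn_trans (le y) yb.
Qed.

(** [table_best] and [table_trace] make the stored weight a maximum: an upper bound over all
    assignments with the state, attained by the traced one. The zeros from [base i.+1] on are the
    initial contents of the next table. *)
Record table i t : Prop := Table {
  table_counts : forall S S', S \in left_sets i -> S' \in right_sets i ->
    counts_of t (addr i S S') = count F its i S S';
  table_counts0 : forall y, base i.+1 <= y -> counts_of t y = 0;
  table_reached0 : forall y, base i.+1 <= y -> reached_of t y = 0;
  table_pred_le : forall y, pred_of t y <= y;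
  table_best : forall a S', S' \in right_sets i ->
    (value F its W i a S' <= best_of t (addr i (later F its i a) S'))%R;
  table_trace : forall S S', S \in left_sets i -> S' \in right_sets i ->
    later F its i (trace t i (addr i S S')) = S /\
    value F its W i (trace t i (addr i S S')) S' = best_of t (addr i S S') }.

Lemma processed0 i t : table i t -> processed i t [::] t.
Proof.
move=> [_ C D P _ _]; split=> // y; last by move=> /D ->.
by rewrite big_nil; case: ltnP => // /C.
Qed.

Lemma table_step i t0 t : i < N ->
  table i t0 -> processed i t0 (events i (left_sets i)) t -> table i.+1 t.
Proof.
move=> iN [T1 T2 T3 T4 T5 T6] [P1 P2 P3 P4 P5 P6 P7 P8].
have uniq_right j : uniq (right_sets j) by apply: fam_uniq.
have targetE S S' b T T' : S \in left_sets i -> S' \in right_sets i.+1 ->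
    T \in left_sets i.+1 -> T' \in right_sets i.+1 ->
    (target_addr i (S, S', b) == addr i.+1 T T') = (T' == S') && (pstep F its i b S == T).
  move=> Si S'i Ti T'i; apply/eqP/andP => [E|[/eqP -> /eqP <-] //].
  by have [-> ->] := addr_inj iN (fam_step b Si) S'i Ti T'i E; rewrite !eqxx.
split.
- move=> T T' Ti T'i; rewrite P1 ifF; last by rewrite ltnNge leq_addr.
  rewrite (count_rec F its_uniq its_all) // big_flatten big_map.
  apply: eq_big_seq => S Si; rewrite big_flatten big_map.
  transitivity (\sum_(S' <- right_sets i.+1) (T' == S') * \sum_(b <- branches its i)
    ((pstep F its i b S == T) && ok its i S S')
      * count F its i S (pstep F its (N + N - i.+1) b S')).
    apply: eq_big_seq => S' S'i; rewrite big_map big_distrr /=.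
    apply: eq_bigr => b _; rewrite targetE // /event_ok /source_addr /=.
    by rewrite T1 ?right_step // mulnA -!mulnb !mulnA.
  by rewrite sum_uniq_eq.
- move=> y yb; rewrite P1 ifF; last first.
    by rewrite ltnNge (leq_trans _ yb) // [base i.+2]baseS leq_addr.
  rewrite big_seq big1 // => e /(target_lt iN) ey.
  by rewrite ltn_eqF // (leq_trans ey).
- move=> y yb; apply/eqP; rewrite -leqn0 leqNgt; apply/negP=> Dy.
  have [|e /(target_lt iN) ey [E _ _ _]] := P8 y _ Dy.
    by rewrite (leq_trans _ yb) // [base i.+2]baseS leq_addr.
  by move: ey; rewrite E ltnNge yb.
- exact: P5.
(* The event that follows [a] itself; the upper bound at its source transfers to its target. *)
- move=> a S' S'i; pose e : event := (later F its i a, S', bit a (pcode its i)).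
  have ee : e \in events i (left_sets i).
    by apply/eventsP; split; rewrite ?later_fam ?bit_branches // ltnW.
  rewrite (value_rec F its_uniq its_all) // (later_step F its_uniq its_all) //.
  apply: le_trans (P7 e ee); rewrite lerD2r T5 //.
  exact: right_step.
- move=> T T' Ti T'i; set tr := trace _ _ _.
  (* [T] is the state of some assignment, whose event has therefore reached the cell. The recorded
     event may be a different one with the same target. *)
  have [a _ aT] : exists2 a : {ffun 'I_n -> bool}, true & later F its i.+1 a = T.
    by move: Ti; rewrite /left_sets (mem_fam F its_uniq its_all) // => /imsetP[a _ ->]; exists a.
  pose e : event := (later F its i a, T', bit a (pcode its i)).
  have ee : e \in events i (left_sets i).
    by apply/eventsP; split; rewrite ?later_fam ?bit_branches // ltnW.
  have := P6 e ee; rewrite {1}/target_addr /= -(later_step F its_uniq its_all) // aT => Dy.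
  have [|[[S S'] b] /[dup] ei /eventsP[Si S'i bi] [/eqP]] := P8 _ _ Dy.
    exact: leq_addr.
  rewrite targetE // => /andP[/eqP ? /eqP bT] Py By Vy; subst S'.
  have -> : tr = assign (trace t0 i (source_addr i (S, T', b))) (pcode its i) b.
    rewrite /tr /= Py By lt0b; congr assign.
    by apply: (eq_trace (b := base i.+1)) => //; apply: source_lt.
  have [l0 v0] := T6 S _ Si (right_step b iN T'i).
  rewrite (later_step F its_uniq its_all) // (value_rec F its_uniq its_all) //.
  rewrite bit_assign // later_assign // value_assign //.
  by rewrite /source_addr /= l0 v0 bT Vy.
Qed.

Lemma table0 t :
  (forall y, counts_of t y = (y == 0)) -> (forall y, reached_of t y = (y == 0)) ->
  (forall y, pred_of t y = 0) -> (forall y, best_of t y = 0%R) -> table 0 t.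
Proof.
move=> C D P V.
have right0 S' : S' \in right_sets 0 -> S' = set0.
  move=> S'0; apply/setP=> j; rewrite inE; apply/negP=> jS'.
  by have := fam_earlier its_uniq its_all (leq0n _) S'0 jS'.
have base1 y : base 1 <= y -> (y == 0) = false.
  by rewrite baseS => /(leq_trans (leq_addl _ _)); case: y => //; rewrite leqNgt expn_gt0.
split=> [S S'|y|y|y|a S' _|S S'].
- rewrite inE => /eqP -> /right0 ->; rewrite count0 // C.
  by rewrite /addr /base bitmask0 mul0n.
- by rewrite C => /base1 ->.
- by rewrite D => /base1 ->.
- by rewrite P.
- by rewrite value0 V.
- rewrite inE => /eqP -> _; rewrite value0 V; split=> //.
  exact: later_satisfied0.
Qed.

Lemma table_count t : table N t -> counts_of t (base N) = count_sat F.
Proof.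
move=> [T1 _ _ _ _ _]; rewrite -(count_top F its_all).
have full : set0 \in fam F its N by rewrite (fam_full F its_uniq its_all) inE.
have rightN : set0 \in right_sets N by rewrite /right_sets addnK.
by rewrite -T1 // /addr bitmask0 !addn0.
Qed.

Lemma table_maximum t (w : 'I_m -> R) : table N t -> (forall j : 'I_m, W j = w j) ->
  maximizes_weight F w (trace t N (base N)).
Proof.
move=> [_ _ _ _ T5 T6] Ww b.
have full : set0 \in fam F its N by rewrite (fam_full F its_uniq its_all) inE.
have addrN : addr N set0 set0 = base N by rewrite /addr bitmask0 !addn0.
have rightN : set0 \in right_sets N by rewrite /right_sets addnK.
have [_ v] := T6 set0 set0 full rightN.
have lateN : later F its N b = set0 by apply/later_satisfied_top => u; rewrite pos_lt.
by have := T5 b set0 rightN; rewrite lateN -v addrN !(value_top F its_all _ Ww).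
Qed.

(** * Processing one more event *)

Section ProcessOne.

Variables (i : nat) (t0 t t' : memo) (es : seq event) (e : event).
Hypothesis src_lt : source_addr i e < base i.+1.
Hypothesis t_proc : processed i t0 es t.
Hypothesis t'_counts : forall y, counts_of t' y = counts_of t y +
  (target_addr i e == y) * (event_ok i e * counts_of t (source_addr i e)).

Let cand := (best_of t (source_addr i e) + event_gain i e)%R.

Let candE : cand = (best_of t0 (source_addr i e) + event_gain i e)%R.
Proof. by rewrite /cand (proc_best t_proc). Qed.

Let new_counts y : counts_of t' y = if y < base i.+1 then counts_of t0 y
  else \sum_(e' <- rcons es e) (target_addr i e' == y) *
    (event_ok i e' * counts_of t0 (source_addr i e')).
Proof.
rewrite t'_counts !(proc_counts t_proc) src_lt; case: ifP => yb.
  by rewrite gtn_eqF ?addn0 // (leq_trans yb) ?target_ge.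
by rewrite -cats1 big_cat big_seq1.
Qed.

Lemma processed_keep :
  0 < reached_of t (target_addr i e) -> (cand <= best_of t (target_addr i e))%R ->
  reached_of t' =1 reached_of t -> pred_of t' =1 pred_of t -> bit_of t' =1 bit_of t ->
  best_of t' =1 best_of t -> processed i t0 (rcons es e) t'.
Proof.
rewrite candE; case: t_proc => _ P2 P3 P4 P5 P6 P7 P8 De Ve tD tP tB tV.
split=> // [y|y|y|y|e'|e'|y yb]; rewrite ?tD ?tP ?tB ?tV; eauto.
- by rewrite mem_rcons inE => /orP[/eqP ->|/P6].
- by rewrite mem_rcons inE => /orP[/eqP ->|/P7].
- by move=> /(P8 y yb)[e' e'es H]; exists e'; rewrite // mem_rcons inE e'es orbT.
Qed.

Lemma processed_record :
  (0 < reached_of t (target_addr i e) -> (best_of t (target_addr i e) <= cand)%R) ->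
  (forall y, reached_of t' y = if y == target_addr i e then 1 else reached_of t y) ->
  (forall y, pred_of t' y = if y == target_addr i e then source_addr i e else pred_of t y) ->
  (forall y, bit_of t' y = if y == target_addr i e then e.2 : nat else bit_of t y) ->
  (forall y, best_of t' y = if y == target_addr i e then cand else best_of t y) ->
  processed i t0 (rcons es e) t'.
Proof.
rewrite candE; case: t_proc => _ P2 P3 P4 P5 P6 P7 P8 De tD tP tB tV.
have low y : y < base i.+1 -> (y == target_addr i e) = false.
  by move=> yb; rewrite ltn_eqF // (leq_trans yb) ?target_ge.
split=> // [y yb|y yb|y yb|y|e'|e'|y yb].
- by rewrite tP low // P2.
- by rewrite tB low // P3.
- by rewrite tV low // P4.
- rewrite tP; case: eqP => // ->.
  exact/ltnW/(leq_trans src_lt)/target_ge.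
- rewrite tD mem_rcons inE; case: (e' =P e) => /= [->|_ /P6 e'D]; first by rewrite eqxx.
  by case: eqP.
- rewrite tV mem_rcons inE; case: (e' =P e) => /= [->|_ e'es]; first by rewrite eqxx.
  case: eqP => [E|_]; last exact: P7.
  by apply: le_trans (P7 _ e'es) _; rewrite E; apply: De; rewrite -E; apply: P6.
- rewrite tD tP tB tV; case: eqP => [-> _|_ /(P8 y yb)[e' e'es H]].
    by exists e; rewrite ?mem_rcons ?inE ?eqxx.
  by exists e'; rewrite // mem_rcons inE e'es orbT.
Qed.

End ProcessOne.

End Table.

(** * Programs *)

Declare Scope ram_scope.
Delimit Scope ram_scope with ram.
Notation "p ;; q" := (Seq p q) (at level 90, right associativity) : ram_scope.
Notation "e + f" := (IAdd e f) : ram_scope.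
Notation "e - f" := (ISub e f) : ram_scope.
Notation "e <= f" := (TLe e f) : ram_scope.
Notation "x ! e" := (ILoad x e) (at level 30, e at level 1) : ram_scope.
Notation "# c" := (IConst c) (at level 1, format "# c") : ram_scope.
Notation "$ x" := (ILoad x (IConst 0)) (at level 1, format "$ x") : ram_scope.
Notation "'put' x := f" := (IStore x (IConst 0) f)
  (at level 80, x at level 0) : ram_scope.
Notation "'put' x ! e := f" := (IStore x e f)
  (at level 80, x at level 0, e at level 1) : ram_scope.
Notation "'while' b 'do' p 'od'" := (While b p) (at level 0) : ram_scope.
Notation "'when' b 'then' p 'fi'" := (If b p Skip) (at level 0) : ram_scope.
Notation "'when' b 'then' p 'else' q 'fi'" := (If b p q) (at level 0) : ram_scope.

(* Names of arrays.  The first ones are only used at address 0, as scalar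
   variables; input and output are the arrays 0 and 1. *)
Notation nb_vars := 2 (only parsing).
Notation nb_clauses := 3 (only parsing).
Notation nb_items := 4 (only parsing).
Notation input_ptr := 5 (only parsing).
Notation clause_nb := 6 (only parsing).
Notation nb_literals := 7 (only parsing).
Notation row_start := 8 (only parsing).
Notation power := 9 (only parsing).
Notation index := 17 (only parsing).
Notation item := 18 (only parsing).
Notation ptr1 := 19 (only parsing).
Notation source := 20 (only parsing).
Notation result := 23 (only parsing).
Notation rest := 24 (only parsing).
Notation list_end := 25 (only parsing).
Notation active := 26 (only parsing).
Notation ptr2 := 27 (only parsing).
Notation old_base := 28 (only parsing).
Notation new_base := 29 (only parsing).

Notation powers := 10 (only parsing).
Notation rows := 11 (only parsing).
Notation literals := 12 (only parsing).
Notation items := 13 (only parsing).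
Notation clause_pos := 14 (only parsing).
Notation sets := 30 (only parsing).
Notation starts := 31 (only parsing).
Notation seen := 32 (only parsing).
Notation nexts := 33 (only parsing).
Notation counts := 34 (only parsing).
Notation reached := 35 (only parsing).
Notation preds := 36 (only parsing).
Notation bits := 37 (only parsing).
Notation source_ptr := 38 (only parsing).
Notation target_ptr := 39 (only parsing).

Notation weights := 0 (only parsing).
Notation best := 1 (only parsing).
Notation candidate := 2 (only parsing).

(** A row has [2 N] cells rather than [2 n]: looking up the code of a clause item stays inside the
    row and finds 0, in agreement with [literal_in]. *)
Definition literals_prog : prog := (
  while #1 <= $nb_literals do
    put literals ! ($row_start + 0 ! $input_ptr + 0 ! $input_ptr + 0 ! ($input_ptr + #1))
      := #1 ;;
    put input_ptr := $input_ptr + #2 ;;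
    put nb_literals := $nb_literals - #1
  od)%ram.

Definition clauses_prog : prog := (
  put input_ptr := $nb_items + #2 ;;
  put power := #1 ;;
  put row_start := #0 ;;
  put clause_nb := #0 ;;
  while $clause_nb + #1 <= $nb_clauses do
    put powers ! $clause_nb := $power ;;
    put rows ! $clause_nb := $row_start ;;
    put nb_literals := 0 ! $input_ptr ;;
    put input_ptr := $input_ptr + #1 ;;
    literals_prog ;;
    put power := $power + $power ;;
    put row_start := $row_start + ($nb_items + $nb_items) ;;
    put clause_nb := $clause_nb + #1
  od)%ram.

Definition items_prog : prog := (
  put index := #0 ;;
  while $index + #1 <= $nb_items do
    put item := 0 ! ($index + #2) ;;
    put items ! $index := $item ;;
    put items ! ($nb_items + $nb_items - ($index + #1)) := $item ;;
    when $nb_vars <= $item then put clause_pos ! ($item - $nb_vars) := $index fi ;;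
    put index := $index + #1
  od)%ram.

Definition setup_prog : prog := (
  put nb_vars := 0 ! #0 ;;
  put nb_clauses := 0 ! #1 ;;
  put nb_items := $nb_vars + $nb_clauses ;;
  clauses_prog ;;
  items_prog)%ram.

(* [rest] holds the bits of [source] below the current one, which is thus read by a
   comparison with a power of 2. *)
Definition step_prog (b : bool) : prog := (
  put result := $source ;;
  put rest := $source ;;
  put clause_nb := $nb_clauses ;;
  while #1 <= $clause_nb do
    put clause_nb := $clause_nb - #1 ;;
    when powers ! $clause_nb <= $rest then
      put rest := $rest - powers ! $clause_nb ;;
      (* Two inequalities test whether the item is this very clause. *)
      when $item <= $nb_vars + $clause_nb then
        when $nb_vars + $clause_nb <= $item then
          put result := $result - powers ! $clause_nb
        fi
      fi
    else
      (* By truncated subtraction, [active] is positive exactly when the clause comes after the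
         item, here in the order and, in the second half, in its reverse. *)
      put active := clause_pos ! $clause_nb - $index ;;
      when $nb_items <= $index then
        put active := ($nb_items + $nb_items) - (clause_pos ! $clause_nb + $index + #1)
      fi ;;
      when #1 <= $active then
        when #1 <= literals ! (rows ! $clause_nb + $item + $item + #b) then
          put result := $result + powers ! $clause_nb
        fi
      fi
    fi
  od)%ram.

Arguments upd T mem x i v y j /.

(* The cell [p] of [sets] holds a listed set, and the cells [2 p + b] of [nexts] the
   sets that follow it.  [seen], indexed by bitmasks, holds the number of the last
   family that contains a set, so that it need not be cleared. *)
Definition add_prog (b : bool) : prog := (
  put nexts ! ($ptr1 + $ptr1 + #b) := $result ;;
  when $index + #1 <= seen ! $result then Skip else
    put seen ! $result := $index + #1 ;;
    put sets ! $list_end := $result ;;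
    put list_end := $list_end + #1
  fi)%ram.

Definition inner_pass : prog := (
  put source := sets ! $ptr1 ;;
  step_prog false ;; add_prog false ;;
  step_prog true ;; add_prog true ;;
  put ptr1 := $ptr1 + #1)%ram.

Definition pass_prog : prog := (
  put sets ! #0 := #0 ;;
  put starts ! #0 := #0 ;;
  put starts ! #1 := #1 ;;
  put list_end := #1 ;;
  put index := #0 ;;
  while $index + #1 <= $nb_items + $nb_items do
    put item := items ! $index ;;
    put ptr1 := starts ! $index ;;
    while $ptr1 + #1 <= starts ! ($index + #1) do inner_pass od ;;
    (* The family [index + 1] is now complete, and its end is the start of the family
       [index + 2]. *)
    put starts ! ($index + #2) := $list_end ;;
    put index := $index + #1
  od)%ram.

Definition record_prog (b : bool) : prog := (
  VStore best $target_ptr (VLoad candidate #0) ;;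
  put reached ! $target_ptr := #1 ;;
  put preds ! $target_ptr := $source_ptr ;;
  put bits ! $target_ptr := #b)%ram.

(* [active] is positive if the item is a variable, or a clause that belongs to one
   of the two sets, that is, a satisfied one. *)
Definition event_prog (b : bool) : prog := (
  put source_ptr := $old_base + (sets ! $ptr1 + nexts ! ($ptr2 + $ptr2 + #b)) ;;
  put target_ptr := $new_base + (nexts ! ($ptr1 + $ptr1 + #b) + sets ! $ptr2) ;;
  put active := ($nb_vars - $item) + ((sets ! $ptr1 + sets ! $ptr2)
    - (nexts ! ($ptr1 + $ptr1 + #b) + nexts ! ($ptr2 + $ptr2 + #b))) ;;
  VStore candidate #0 (VLoad best $source_ptr) ;;
  when #1 <= $active then
    put counts ! $target_ptr := counts ! $target_ptr + counts ! $source_ptr ;;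
    when $nb_vars <= $item then
      VStore candidate #0
        (VAdd (VLoad candidate #0) (VLoad weights ($item - $nb_vars)))
    fi
  fi ;;
  when #1 <= reached ! $target_ptr then
    If (TLeV (VLoad candidate #0) (VLoad best $target_ptr)) Skip (record_prog b)
  else
    record_prog b
  fi)%ram.

(** [ptr2] runs over the promises after the item, listed in the family [N + N - i.+1]; their stored
    successors are the promises before the item. *)
Definition row_prog : prog := (
  put ptr2 := starts ! ($nb_items + $nb_items - ($index + #1)) ;;
  while $ptr2 + #1 <= starts ! ($nb_items + $nb_items - $index) do
    event_prog false ;;
    when $nb_vars <= $item then Skip else event_prog true fi ;;
    put ptr2 := $ptr2 + #1
  od)%ram.

Definition table_prog : prog := (
  put counts ! #0 := #1 ;;
  put reached ! #0 := #1 ;;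
  put old_base := #0 ;;
  put index := #0 ;;
  while $index + #1 <= $nb_items do
    put item := items ! $index ;;
    put new_base := $old_base + $power ;;
    put ptr1 := starts ! $index ;;
    while $ptr1 + #1 <= starts ! ($index + #1) do
      row_prog ;;
      put ptr1 := $ptr1 + #1
    od ;;
    put old_base := $new_base ;;
    put index := $index + #1
  od)%ram.

(** The output array is initially 0, so only the true values are written. *)
Definition trace_prog : prog := (
  put source_ptr := $old_base ;;
  put index := $nb_items ;;
  while #1 <= $index do
    put index := $index - #1 ;;
    when $nb_vars <= items ! $index then Skip else
      when #1 <= bits ! $source_ptr then put 1 ! (items ! $index) := #1 fi
    fi ;;
    put source_ptr := preds ! $source_ptr
  od)%ram.

Definition solve_prog : prog := (setup_prog ;; pass_prog ;; table_prog)%ram.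

Definition count_prog : prog := (
  solve_prog ;;
  put 1 ! #0 := counts ! $old_base)%ram.

Definition maxsat_prog : prog := (solve_prog ;; trace_prog)%ram.

(** Symbolic execution of straight-line code; the time bound is left to unification. *)
Ltac ram := repeat first
  [ eapply runs_seq | eapply runs_istore; rewrite /= | eapply runs_vstore | eapply runs_skip]; rewrite /=.

Ltac unframe H :=
  repeat match goal with |- context [imem _ ?x] => rewrite (H x isT) end;
  rewrite /=.

(** * Look-up arrays and the transition of one set *)

Section Programs.

Variables (n m : nat) (F : cnf n m) (its : seq ('I_n + 'I_m)) (R : realDomainType).
Hypothesis its_uniq : uniq its.
Hypothesis its_all : forall u, u \in its.

Let N := size its.

Implicit Types (s : state R) (M : nat -> nat -> nat).

Record env M : Prop := Env {
  env_n : M nb_vars 0 = n;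
  env_m : M nb_clauses 0 = m;
  env_N : M nb_items 0 = N;
  env_power : M power 0 = 2 ^ m;
  env_powers : forall j, j < m -> M powers j = 2 ^ j;
  env_rows : forall j, j < m -> M rows j = j * (N + N);
  env_literals : forall (j : 'I_m) x (b : bool), x < N ->
    (0 < M literals (j * (N + N) + x + x + b)) = literal_in F x b j;
  env_items : forall i, i < N + N -> M items i = pcode its i;
  env_pos : forall j : 'I_m, M clause_pos j = pos its (inr j) }.

Definition env_arrays :=
  [:: nb_vars; nb_clauses; nb_items; power; powers; rows; literals; items; clause_pos].

Lemma env_eq M M' : {in env_arrays, M' =1 M} -> env M -> env M'.
Proof. by move=> MM' [? ? ? ? ? ? ? ? ?]; split=> *; rewrite MM'; eauto. Qed.

Lemma env_frame p s s' :
  frame p s s' -> all (fun x => x \notin ints_written p) env_arrays ->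
  env (imem s) -> env (imem s').
Proof. by move=> [fr _] /allP ok; apply: env_eq => x /ok/fr. Qed.

Lemma env_upd M x i v : x \notin env_arrays -> env M -> env (upd M x i v).
Proof.
move=> xa; apply: env_eq => y ya; rewrite upd_frame //.
by apply: contraNneq xa => <-.
Qed.

Lemma pcode_lt i : i < N + N -> pcode its i < N.
Proof.
suff H i' : i' < N -> pcode its i' < N.
  have [/H //|iN i2N] := ltnP i N.
  have -> : i = N + N - (N + N - i.+1).+1 by lia.
  by rewrite pcode_rev //; [apply: H|]; lia.
move=> /(pos_surj its_uniq)[u <-]; rewrite pcode_pos // /N (size_items its_uniq its_all).
by case: u => [x|c] /=; rewrite ?ltn_add2l // ltn_addr.
Qed.

Lemma step_runs b s i Z :
  env (imem s) -> i < N + N -> imem s index 0 = i -> imem s item 0 = pcode its i ->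
  imem s source 0 = bitmask Z ->
  runs (step_prog b) s (m * 20 + 10)
    (fun s' => imem s' result 0 = bitmask (pstep F its i b Z)).
Proof.
move=> es iN si sit sz; set Z' := pstep F its i b Z.
have pN := pcode_lt iN.
rewrite /step_prog; apply: runs_le; first ram.
(* The mask of [Z] is corrected in place from the top: bits from [m - t] on are already those of
   [Z'], lower ones still those of [Z]. *)
- apply: runs_post (runs_while (h := m) (I := fun t s' =>
    [/\ imem s' clause_nb 0 = m - t, imem s' rest 0 = bitmask (below (m - t) Z)
      & imem s' result 0 = bitmask (below (m - t) Z) + bitmask (above (m - t) Z')]) _ _ _) _.
  + rewrite /= /upd /= (env_m es) subn0 below_top above_top bitmask0 addn0.
    by [].
  + move=> t s1 fr1 tm [j1 rem1 res1].
    have [fr1i _] := fr1.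
    have e1 : env (imem s1).
      by apply: env_frame fr1 isT _; do 3!apply: env_upd => //.
    split; first by rewrite /= j1 subn_gt0.
    have jm : m - t.+1 < m by lia.
    have [j Ej] : exists j : 'I_m, m - t.+1 = j by exists (Ordinal jm).
    have mt : m - t = j.+1 by lia.
    rewrite Ej in jm *.
    have j1' : imem s1 clause_nb 0 - 1 = j by rewrite j1 mt subn1.
    have [n1 _ N1 _ pw1 rows1 lit1 _ pos1] := e1.
    have i1 : imem s1 index 0 = i by rewrite fr1i.
    have it1 : imem s1 item 0 = pcode its i by rewrite fr1i.
    have jZ' : (j \in Z') = if j \in Z then pcode its i != n + j
        else pact its i j && literal_in F (pcode its i) b j.
      by rewrite inE.
    rewrite mt bitmask_belowS in rem1; rewrite mt bitmask_belowS in res1.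
    have pwj := pw1 j jm; have lt_below := bitmask_below_lt Z (ltnW jm).
    have aj := bitmask_above j Z'.
    ram; eapply runs_if => /= jZ; rewrite ?j1' pwj rem1 in jZ; ram.
      have {}jZ : j \in Z by move: jZ lt_below; case: (j \in Z) => //=; lia.
      rewrite jZ mul1n in jZ' rem1 res1.
      have goalE r : imem s1 result 0 - (1 - (j \in Z')) * 2 ^ j = r ->
          [/\ imem s1 clause_nb 0 - 1 = j :> nat,
            imem s1 rest 0 - imem s1 powers (imem s1 clause_nb 0 - 1) =
              bitmask (below j Z)
          & r = bitmask (below j Z) + bitmask (above j Z')].
        move=> <-; rewrite j1' pwj rem1 res1 aj; split=> //=; first by lia.
        by case: (j \in Z') => /=; lia.
      eapply runs_if => /= c1; last first.
        ram; apply: goalE; rewrite jZ' ?n1 ?j1' ?it1 in c1 *.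
        by have -> : pcode its i != n + j; [lia | rewrite subnn mul0n subn0].
      eapply runs_if => /= c2; ram; apply: goalE;
        rewrite jZ' ?j1' ?pwj ?n1 ?it1 in c1 c2 *.
        by have -> : pcode its i = n + j; [lia | rewrite eqxx subn0 mul1n].
      by have -> : pcode its i != n + j; [lia | rewrite subnn mul0n subn0].
    have {}jZ : (j \in Z) = false by apply: contraNF jZ => ->; rewrite mul1n leq_addr.
    rewrite jZ add0n in rem1 res1 jZ'.
    eapply (runs_post (Q := fun s2 => (0 < imem s2 active 0) = pact its i j)).
      eapply runs_if => /= iN'; ram; rewrite ?N1 i1 in iN'; rewrite j1' pos1 i1 ?N1 /pact;
        [rewrite ifF | rewrite ifT]; rewrite -/N; lia.
    move=> s2 [fr2 _] act2; have res2 := fr2 result isT; have rem2 := fr2 rest isT.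
    have goalE r : r = imem s1 result 0 + (j \in Z') * 2 ^ j ->
        [/\ imem s2 clause_nb 0 = j, imem s2 rest 0 = bitmask (below j Z)
        & r = bitmask (below j Z) + bitmask (above j Z')].
      by move=> ->; unframe fr2; rewrite j1' rem1 res1 aj -addnA [X in _ + X]addnC.
    eapply runs_if => /= c1; rewrite act2 in c1; last first.
      ram; apply: goalE; rewrite jZ' (negbTE c1) /= addn0.
      by unframe fr2.
    rewrite c1 /= in jZ'; eapply runs_if => /=; unframe fr2;
      rewrite j1' it1 rows1 // lit1 // => c2; ram; apply: goalE;
      unframe fr2; rewrite jZ' ?c2 ?(negbTE c2) ?j1' ?pwj ?mul1n ?addn0 //.
  + by move=> s1 _ [+ _ _] /=; rewrite subnn => ->.
  + by move=> s1 _ [_ _]; rewrite subnn below0 bitmask0 above0.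
- lia.
Qed.

End Programs.

(** * Correctness of the programs *)

Lemma drop_cons_nth (xs : seq nat) p a t :
  drop p xs = a :: t -> nth 0 xs p = a /\ drop p.+1 xs = t.
Proof.
move=> E; split; first by rewrite -[p]addn0 -nth_drop E.
by rewrite -addn1 addnC -drop_drop E /= drop0.
Qed.

(** * Reading the input *)

Section Setup.

Variables (n m : nat) (F : cnf n m) (its : seq ('I_n + 'I_m)) (R : realDomainType).
Hypothesis its_uniq : uniq its.
Hypothesis its_all : forall u, u \in its.

Let N := size its.

Implicit Types (s : state R) (M : nat -> nat -> nat) (l : 'I_n * bool).

Let xs := [:: n; m] ++ [seq code_item u | u <- its]
    ++ flatten [seq code_clause (F j) | j <- enum 'I_m].

Definition literal_addr (j : nat) l := j * (N + N) + l.1 + l.1 + l.2.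

Definition clause_addrs (j : 'I_m) := [seq literal_addr j l | l <- enum (F j)].

Lemma mem_clause_addrs (j : 'I_m) x (b : bool) : x < N ->
  (j * (N + N) + x + x + b \in flatten [seq clause_addrs j' | j' <- enum 'I_m])
  = literal_in F x b j.
Proof.
have NE : N = n + m by apply: size_items.
(* Addresses decode uniquely: dividing by [N + N] gives the row, and half and parity of the
   remainder give the variable and the sign. *)
have row_eq (j1 j2 x1 x2 : nat) (b1 b2 : bool) : x1 < N -> x2 < N ->
    j1 * (N + N) + x1 + x1 + b1 = j2 * (N + N) + x2 + x2 + b2 ->
    [/\ j1 = j2, x1 = x2 & b1 = b2].
  move=> x1N x2N; rewrite -!addnA => E.
  have r1 : x1 + (x1 + b1) < N + N by case: b1 {E}; lia.
  have r2 : x2 + (x2 + b2) < N + N by case: b2 {E}; lia.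
  have N0 : 0 < N + N by lia.
  have Ej : j1 = j2.
    by have := congr1 (divn^~ (N + N)) E; rewrite !divnMDl // !divn_small // !addn0.
  move: E; rewrite Ej => /addnI E; split=> //; first by case: b1 b2 E {r1 r2} => -[] /=; lia.
  by case: b1 b2 E {r1 r2} => -[] //=; lia.
move=> xN; apply/flatten_mapP/existsP => [[j' _ /mapP[l]]|[l /and3P[lF /eqP lx /eqP lb]]].
  rewrite mem_enum => lF E; have lN : l.1 < N by rewrite NE ltn_addr.
  have [/val_inj jj' xl bl] := row_eq _ _ _ _ _ _ xN lN E.
  by exists l; rewrite jj' lF xl bl !eqxx.
exists j; rewrite ?mem_enum //; apply/mapP; exists l; rewrite ?mem_enum //.
by rewrite /literal_addr lx lb.
Qed.

Lemma literals_runs s (j : 'I_m) ys tl :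
  imem s row_start 0 = j * (N + N) -> imem s nb_literals 0 = #|F j| ->
  imem s 0 =1 nth 0 xs ->
  drop (imem s input_ptr 0) xs =
    flatten [seq [:: nat_of_ord l.1; nat_of_bool l.2] | l <- enum (F j)] ++ tl ->
  (forall y, (0 < imem s literals y) = (y \in ys)) ->
  runs literals_prog s (n * 10 + 10) (fun s' =>
    drop (imem s' input_ptr 0) xs = tl /\
    forall y, (0 < imem s' literals y) = (y \in ys ++ clause_addrs j)).
Proof.
move=> srow snb s0 sdrop slit.
apply: runs_weak (runs_while (h := #|F j|) (T := 3) (I := fun r s' =>
  [/\ imem s' nb_literals 0 = #|F j| - r,
      drop (imem s' input_ptr 0) xs = flatten [seq [:: nat_of_ord l.1; nat_of_bool l.2]
        | l <- drop r (enum (F j))] ++ tl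
    & forall y, (0 < imem s' literals y) =
        (y \in ys ++ [seq literal_addr j l | l <- take r (enum (F j))])]) _ _ _) _ _.
- by rewrite subn0 drop0 take0 /= cats0; split.
- move=> r s1 fr1 rF [nb1 drop1 lit1]; have [f1 _] := fr1.
  have rF' : r < size (enum (F j)) by rewrite -cardE.
  have [l0 _] : exists l0 : 'I_n * bool, true.
    by case: (enum (F j)) rF' => // l0; exists l0.
  set l := nth l0 (enum (F j)) r.
  split; first by rewrite /= nb1 subn_gt0.
  move: drop1; rewrite (drop_nth l0 rF') /= => /drop_cons_nth[v1 /[dup] drop1].
  move=> /drop_cons_nth[v2 drop2].
  have in1 : imem s1 0 =1 nth 0 xs by unframe f1.
  apply: runs_le; first ram; last by [].
  rewrite !in1 addn1 v1 v2 addn2 nb1; split=> //; first by rewrite -subnDA addn1.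
  move=> y; rewrite (take_nth l0 rF') map_rcons mem_cat mem_rcons inE orbCA -mem_cat -lit1.
  have -> : imem s1 row_start 0 + l.1 + l.1 + l.2 = literal_addr j l.
    by unframe f1; rewrite srow.
  by case: eqP.
- by move=> s1 _ [+ _ _] /= => ->; rewrite subnn.
(* A clause has at most [2 n] literals, and each iteration costs 3 assignments and a test. *)
- apply: (@leq_trans (n * 2 * 4).+1); last by lia.
  rewrite ltnS leq_mul2r; apply: leq_trans (max_card _) _.
  by rewrite card_prod card_ord card_bool.
- move=> s1 _ [_ + +]; rewrite cardE drop_size take_size /= => -> lit1; split=> //.
Qed.

Lemma clauses_runs s :
  imem s nb_clauses 0 = m -> imem s nb_items 0 = N ->
  imem s 0 =1 nth 0 xs -> (forall y, imem s literals y = 0) ->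
  runs clauses_prog s (m * (n * 10 + 20) + 10) (fun s' =>
   [/\ imem s' power 0 = 2 ^ m,
       forall j, j < m -> imem s' powers j = 2 ^ j,
       forall j, j < m -> imem s' rows j = j * (N + N)
     & forall (j : 'I_m) x (b : bool), x < N ->
         (0 < imem s' literals (j * (N + N) + x + x + b)) = literal_in F x b j]).
Proof.
move=> sm sN s0 slit; set cls := enum 'I_m.
have sz : size cls = m by rewrite size_enum_ord.
apply: runs_le; first ram.
- apply: runs_post (runs_while (h := m) (I := fun j s' =>
    [/\ imem s' clause_nb 0 = j, imem s' power 0 = 2 ^ j,
        imem s' row_start 0 = j * (N + N),
        drop (imem s' input_ptr 0) xs = flatten [seq code_clause (F j') | j' <- drop j cls] /\
        (forall y, (0 < imem s' literals y) =
          (y \in flatten [seq clause_addrs j' | j' <- take j cls]))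
      & forall j', j' < j -> imem s' powers j' = 2 ^ j' /\ imem s' rows j' = j' * (N + N)])
    _ _ _) _.
  + split=> //=; rewrite ?mul0n //; split; last by move=> y; rewrite take0 slit.
    rewrite sN addnC drop0 /xs; have -> : N = size [seq code_item u | u <- its] by rewrite size_map.
    by rewrite /= drop_size_cat.
  + move=> j s1 fr1 jm [c1 pw1 row1 [drop1 lit1] tab1]; have [f1 _] := fr1.
    have in1 : imem s1 0 =1 nth 0 xs by unframe f1.
    have m1 : imem s1 nb_clauses 0 = m by unframe f1.
    have N1 : imem s1 nb_items 0 = N by unframe f1.
    split; first by rewrite /= c1 m1 addn1.
    pose jo := Ordinal jm.
    have jcls : nth jo cls j = jo by apply: val_inj; rewrite /= nth_enum_ord.
    have jsz : j < size cls by rewrite sz.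
    move: drop1; rewrite (drop_nth jo jsz) jcls /= => /drop_cons_nth[nb1 drop1].
    ram; rewrite c1 pw1 row1 in1 nb1 addn1; eapply runs_post.
      by apply: (literals_runs (j := jo) (ys := flatten [seq clause_addrs j' | j' <- take j cls])
        (tl := flatten [seq code_clause (F j') | j' <- drop j.+1 cls])).
    move=> s2 [f2 _] [drop2 lit2]; ram; unframe f2.
    rewrite c1 pw1 row1 N1 addn1; split=> //.
    * by rewrite expnS mul2n addnn.
    * by rewrite mulSn addnC.
    * split=> // y; rewrite lit2 (take_nth jo jsz) jcls map_rcons flatten_rcons.
      by [].
    * move=> j'; rewrite ltnS leq_eqVlt => /orP[/eqP ->|j'j]; first by rewrite eqxx.
      by rewrite ltn_eqF //; apply: tab1.
  + by move=> s1 [f1 _] [+ _ _ _ _] /= => ->; unframe f1; rewrite sm addn1 ltnn.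
  + move=> s1 _ [_ pw1 _ [_ lit1] tab1]; split=> // [j /tab1[]|j /tab1[]|j x b xN] //.
    by rewrite lit1 take_oversize ?sz // mem_clause_addrs.
- by lia.
Qed.

Lemma items_runs s :
  imem s nb_vars 0 = n -> imem s nb_items 0 = N -> imem s 0 =1 nth 0 xs ->
  runs items_prog s (N * 10 + 10) (fun s' =>
    (forall i, i < N + N -> imem s' items i = pcode its i) /\
    forall j : 'I_m, imem s' clause_pos j = pos its (inr j)).
Proof.
move=> sn sN s0.
apply: runs_le; first ram.
- apply: runs_post (runs_while (h := N) (I := fun i s' =>
    [/\ imem s' index 0 = i,
        forall i', i' < i -> imem s' items i' = pcode its i' /\
          imem s' items (N + N - i'.+1) = pcode its i'
      & forall j : 'I_m, pos its (inr j) < i -> imem s' clause_pos j = pos its (inr j)])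
    _ _ _) _.
  + by [].
  + move=> i s1 [f1 _] iN [i1 it1 pos1].
    have in1 : imem s1 0 =1 nth 0 xs by unframe f1.
    have n1 : imem s1 nb_vars 0 = n by unframe f1.
    have N1 : imem s1 nb_items 0 = N by unframe f1.
    split; first by rewrite /= i1 N1 addn1.
    have code1 : nth 0 xs (i + 2) = pcode its i.
      rewrite addn2 /xs /= nth_cat size_map iN /pcode map_cat nth_cat size_map.
      by rewrite iN.
    ram; rewrite i1 in1 code1 N1.
    have items1 i' : i' < i.+1 ->
      (if i' == N + N - i.+1 then pcode its i else
        if i' == i then pcode its i else imem s1 items i') = pcode its i' /\
      (if N + N - i'.+1 == N + N - i.+1 then pcode its i else
        if N + N - i'.+1 == i then pcode its i else imem s1 items (N + N - i'.+1))
        = pcode its i'.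
      rewrite ltnS leq_eqVlt => /orP[/eqP ->|i'i].
        by rewrite !eqxx; case: ifP.
      rewrite !ifF; try lia.
      exact: it1.
    eapply runs_if => /= c; rewrite n1 in c; ram; split; rewrite ?i1 ?n1 ?addn1 //.
    * have [[x|d] ui] := pos_surj its_uniq iN.
        by move: c; rewrite -ui pcode_pos //= leqNgt ltn_ord.
      rewrite -ui pcode_pos //= addKn => j; case: eqP => [/val_inj -> //|jc].
      rewrite ltnS leq_eqVlt => /orP[/eqP/(pos_inj its_all)[jc']|]; first by case: jc; rewrite jc'.
      by rewrite ui; apply: pos1.
    * move=> j; rewrite ltnS leq_eqVlt => /orP[/eqP ji|]; last exact: pos1.
      by case/negP: c; rewrite -ji pcode_pos //= leq_addr.
  + by move=> s1 [f1 _] [+ _ _] /= => ->; unframe f1; rewrite sN addn1 ltnn.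
  + move=> s1 _ [_ it1 pos1]; split=> [i iNN|j]; last exact/pos1/pos_lt.
    have [iN|iN] := ltnP i N; first by case: (it1 i iN).
    have iN' : N + N - i.+1 < N by lia.
    have [_] := it1 _ iN'; have -> : N + N - (N + N - i.+1).+1 = i by lia.
    move=> ->; rewrite -(pcode_rev its_uniq its_all iN'); congr pcode.
    by rewrite -/N; lia.
- by lia.
Qed.

Definition setup_time := m * (n * 10 + 20) + N * 10 + 30.

Lemma setup_runs s :
  imem s 0 =1 nth 0 xs -> (forall y, imem s literals y = 0) ->
  runs setup_prog s setup_time (fun s' => env F its (imem s')).
Proof.
move=> s0 slit; apply: runs_le.
  do 3 (eapply runs_seq; eapply runs_istore; rewrite /=).
  rewrite !s0 /= -(size_items its_uniq its_all) -/N.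
  eapply runs_bind; first exact: clauses_runs.
  move=> s1 [f1 _] [pw1 pws1 rows1 lit1].
  have in1 : imem s1 0 =1 nth 0 xs by unframe f1.
  apply: runs_post; first by apply: items_runs in1; unframe f1.
  move=> s2 [f2 _] [it2 pos2].
  split=> //; unframe f2 => //; unframe f1 => //.
by rewrite /setup_time; lia.
Qed.

End Setup.

(** * Listing all families and their successors in memory *)

Definition concat T (f : nat -> seq T) i := flatten [seq f i' | i' <- iota 0 i].

Lemma concatS T (f : nat -> seq T) i : concat f i.+1 = concat f i ++ f i.
Proof. by rewrite /concat -addn1 iotaD map_cat flatten_cat /= cats0. Qed.

Lemma nth_concat T (f : nat -> seq T) x i k r : i < k -> r < size (f i) ->
  nth x (concat f k) (size (concat f i) + r) = nth x (f i) r.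
Proof.
move=> ik ri; have -> : k = i.+1 + (k - i.+1) by lia.
rewrite /concat iotaD map_cat flatten_cat -/(concat f _) concatS -catA nth_cat.
by rewrite ltnNge leq_addr addKn nth_cat ri.
Qed.

Section Pass.

Variables (n m : nat) (F : cnf n m) (its : seq ('I_n + 'I_m)) (R : realDomainType).
Hypothesis its_uniq : uniq its.
Hypothesis its_all : forall u, u \in its.

Let N := size its.

Implicit Types (Z : {set 'I_m}) (s : state R) (M : nat -> nat -> nat).

Definition stores (l : seq {set 'I_m}) (f : nat -> nat) :=
  forall t, t < size l -> f t = bitmask (nth set0 l t).

Lemma stores_rcons l Z f : stores l f -> f (size l) = bitmask Z -> stores (rcons l Z) f.
Proof.
move=> lf fZ t; rewrite size_rcons ltnS leq_eqVlt nth_rcons.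
by case: ltngtP => // [/lf|->].
Qed.

Definition start i := size (concat (fam F its) i).

Lemma startS i : start i.+1 = start i + size (fam F its i).
Proof. by rewrite /start concatS size_cat. Qed.

Definition all_sets i := concat (fam F its) i.
Definition all_succs i := concat (fun i' => succs F its i' (fam F its i')) i.

Lemma size_succs i l : size (succs F its i l) = (size l).*2.
Proof. by elim: l => //= Z l ->. Qed.

Lemma size_all_succs i : size (all_succs i) = (start i).*2.
Proof.
elim: i => // i IHi.
by rewrite /all_succs concatS startS size_cat IHi size_succs doubleD.
Qed.

Lemma nth_succs i l r (b : bool) : r < size l ->
  nth set0 (succs F its i l) (r.*2 + b) = pstep F its i b (nth set0 l r).
Proof. by elim: l r => //= Z l IHl [|r] rl; [case: (b) | exact: IHl]. Qed.

#[local] Arguments all_sets : simpl never.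
#[local] Arguments all_succs : simpl never.
#[local] Arguments fam : simpl never.

(** [A] is the listed part up to the family [i], [G] the successors recorded for the earlier
    families, and [p] those found so far from the family [i]. The bound on [seen] lets a single
    comparison detect membership in the new family. *)
Record pass_inv i A G p M : Prop := PassInv {
  inv_sets : stores (A ++ foldl (@add_new _) [::] p) (M sets);
  inv_end : M list_end 0 = size (A ++ foldl (@add_new _) [::] p);
  inv_nexts : stores (G ++ p) (M nexts);
  inv_seen : forall z, M seen z <= i.+1;
  inv_seen_now : forall Z : {set 'I_m},
    (i < M seen (bitmask Z)) = (Z \in foldl (@add_new _) [::] p) }.

Lemma pass_inv_eq i A G p M M' :
  {in [:: sets; list_end; nexts; seen], M' =1 M} -> pass_inv i A G p M -> pass_inv i A G p M'.
Proof.
by move=> MM' [S E X V W]; split=> *; rewrite ?/stores => *; rewrite ?MM' ?(S, E, X, V, W).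
Qed.

Lemma add_runs i A G p (b : bool) Z s :
  pass_inv i A G p (imem s) -> imem s index 0 = i -> imem s result 0 = bitmask Z ->
  imem s ptr1 0 + imem s ptr1 0 + b = size (G ++ p) ->
  runs (add_prog b) s 10 (fun s' => pass_inv i A G (rcons p Z) (imem s')).
Proof.
move=> [S E X V Wn] si sr sp; apply: runs_le; first ram.
- eapply runs_if => /= c; rewrite si sr in c; ram.
  + rewrite addn1 Wn in c.
    have pE : foldl (@add_new _) [::] (rcons p Z) = foldl (@add_new _) [::] p.
      by rewrite -cats1 foldl_cat /= {1}/add_new c.
    split=> //=; rewrite ?pE //.
    rewrite -rcons_cat; apply: stores_rcons => [t tl|] /=; rewrite sp sr ?eqxx //.
    by rewrite ltn_eqF ?X.
  + rewrite addn1 Wn in c.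
    have pE : foldl (@add_new _) [::] (rcons p Z) = rcons (foldl (@add_new _) [::] p) Z.
      by rewrite -cats1 foldl_cat /= {1}/add_new (negbTE c).
    rewrite si sr E sp.
    split=> //=; rewrite ?pE -?rcons_cat ?size_rcons ?addn1 //.
    * by apply: stores_rcons => [t tl|] /=; rewrite ?eqxx // ltn_eqF ?S.
    * by apply: stores_rcons => [t tl|] /=; rewrite ?eqxx // ltn_eqF ?X.
    * by move=> z; case: ifP.
    * move=> Z1; rewrite (inj_eq (@bitmask_inj m)) mem_rcons inE.
      by case: eqP => [_|_] /=; rewrite ?Wn ?leqnn.
- by [].
Qed.

Lemma frame_in (l : seq nat) p s s' :
  frame p s s' -> all (fun x => x \notin ints_written p) l -> {in l, imem s' =1 imem s}.
Proof. by move=> [fr _] /allP ok x /ok/fr. Qed.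

Lemma upd_in (l : seq nat) M x i v : x \notin l -> {in l, upd M x i v =1 M}.
Proof. by move=> xl y yl; rewrite upd_frame //; apply: contraNneq xl => <-. Qed.

Lemma inner_body_runs i r s (L := fam F its i) :
  env F its (imem s) -> i < N + N -> imem s index 0 = i -> r < size L ->
  imem s item 0 = pcode its i -> imem s ptr1 0 = start i + r ->
  pass_inv i (all_sets i.+1) (all_succs i) (succs F its i (take r L)) (imem s) ->
  runs inner_pass s (m * 40 + 59) (fun s' =>
    pass_inv i (all_sets i.+1) (all_succs i) (succs F its i (take r.+1 L)) (imem s') /\
    imem s' ptr1 0 = start i + r.+1).
Proof.
move=> es iN si rL sit sp inv; set Z := nth set0 L r.
have -> : succs F its i (take r.+1 L) = rcons (rcons (succs F its i (take r L))
    (pstep F its i false Z)) (pstep F its i true Z).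
  rewrite (take_nth set0 rL) /succs map_rcons flatten_rcons -/(succs _ _ _ _).
  by rewrite -!cats1 -catA.
have sZ : imem s sets (imem s ptr1 0) = bitmask Z.
  have lt : start i + r < size (all_sets i.+1) by rewrite -[size _]/(start _) startS ltn_add2l.
  rewrite sp (inv_sets inv); last by rewrite size_cat ltn_addr.
  by rewrite nth_cat lt nth_concat.
(* Two successors per set: the next free cell of [nexts] is twice the pointer, plus 1 once the
   successor for false is recorded. *)
have sz (b : bool) p : size p = b -> start i + r + (start i + r) + b =
    size (all_succs i ++ (succs F its i (take r L) ++ p)).
  by move=> pb; rewrite !size_cat size_all_succs size_succs size_takel ?(ltnW rL) //; lia.
apply: runs_le; first (eapply runs_seq; eapply runs_istore; rewrite /=).
- eapply runs_bind.
    by apply: (step_runs (F := F) its_uniq its_all false (i := i) (Z := Z)) => //=; apply: env_upd.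
  move=> s1 fr1 r1; have [f1 _] := fr1; eapply runs_bind.
    apply: (add_runs (i := i) (A := all_sets i.+1) (G := all_succs i)
      (p := succs F its i (take r L)) (Z := pstep F its i false Z)); unframe f1 => //.
      by apply: pass_inv_eq inv => x xl; rewrite (frame_in fr1 _ xl) //= (upd_in _ _ _ _ xl) //.
    by rewrite sp (sz false [::]) // cats0.
  move=> s2 fr2 inv2; have [f2 _] := fr2.
  eapply runs_bind.
    apply: (step_runs (F := F) its_uniq its_all true (i := i) (Z := Z)); unframe f2; unframe f1 => //.
    apply: env_frame fr2 isT _; apply: env_frame fr1 isT _; exact: env_upd.
  move=> s3 fr3 r3; have [f3 _] := fr3; eapply runs_bind.
    apply: (add_runs (i := i) (A := all_sets i.+1) (G := all_succs i)
      (p := rcons (succs F its i (take r L)) (pstep F its i false Z))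
      (Z := pstep F its i true Z));
      unframe f3; unframe f2; unframe f1 => //.
      by apply: pass_inv_eq inv2 => x xl; rewrite (frame_in fr3 _ xl).
    by rewrite sp (sz true [:: pstep F its i false Z]) // cats1.
  move=> s4 fr4 inv4; have [f4 _] := fr4.
  ram; split; first by apply: pass_inv_eq inv4 => x xl; rewrite (upd_in _ _ _ _ xl) //.
  by unframe f4; unframe f3; unframe f2; unframe f1; rewrite sp addn1 addnS.
- by lia.
Qed.

Variable width : nat.
Hypothesis fam_width : forall i, i <= N + N -> size (fam F its i) <= width.

Lemma inner_pass_runs i s (L := fam F its i) :
  env F its (imem s) -> i < N + N -> imem s index 0 = i ->
  imem s item 0 = pcode its i -> imem s ptr1 0 = start i ->
  imem s starts i.+1 = start i.+1 ->
  pass_inv i (all_sets i.+1) (all_succs i) [::] (imem s) ->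
  runs (while $ptr1 + #1 <= starts ! ($index + #1) do inner_pass od)%ram
    s (width * (m * 40 + 60)).+1
    (fun s' =>
      pass_inv i (all_sets i.+1) (all_succs i) (succs F its i L) (imem s')).
Proof.
move=> es iN si sit sp sst inv0.
apply: runs_weak (runs_while (h := size L) (T := m * 40 + 59) (I := fun r s' =>
  pass_inv i (all_sets i.+1) (all_succs i) (succs F its i (take r L)) (imem s')
  /\ imem s' ptr1 0 = start i + r) _ _ _) _ _.
- by rewrite take0 addn0.
- move=> r s1 fr1 rL [inv1 p1]; have [f1 _] := fr1; split.
    by rewrite /= p1; unframe f1; rewrite si !addn1 sst startS -addnS leq_add2l.
  apply: inner_body_runs => //; try by unframe f1.
  exact: env_frame fr1 isT es.
- move=> s1 [f1 _] [_ p1]; rewrite /= p1; unframe f1.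
  by rewrite si !addn1 sst startS ltnn.
- by rewrite ltnS leq_mul ?fam_width ?(ltnW iN) // -addnS.
- by move=> s' _; rewrite take_size => -[].
Qed.

Definition pass_time := (N + N) * (width * (m * 40 + 60) + 10) + 10.

Record listed M : Prop := Listed {
  listed_sets : stores (all_sets (N + N).+1) (M sets);
  listed_nexts : stores (all_succs (N + N)) (M nexts);
  listed_starts : forall i, i <= (N + N).+1 -> M starts i = start i }.

Lemma pass_runs s :
  env F its (imem s) -> (forall z, imem s seen z = 0) ->
  runs pass_prog s pass_time (fun s' => listed (imem s')).
Proof.
move=> es seen0.
apply: runs_le; first ram.
- apply: runs_post (runs_while (h := N + N) (I := fun i s' =>
    [/\ pass_inv i (all_sets i.+1) (all_succs i) [::] (imem s'),
        imem s' index 0 = i & forall i', i' <= i.+1 -> imem s' starts i' = start i'])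
    _ _ _) _.
  + split=> //.
      split=> //= [|z|Z]; rewrite ?seen0 //.
      by case=> //= _; rewrite bitmask0.
    by case=> [|[|]].
  + move=> i s1 fr1 iN [inv1 i1 st1]; have [f1 _] := fr1.
    have e1 : env F its (imem s1).
      by apply: env_frame fr1 isT _; do !apply: env_upd => //.
    split; first by rewrite /= i1 (env_N e1) addn1.
    ram; eapply runs_post.
      apply: (inner_pass_runs (i := i)); rewrite //= ?i1 ?st1 ?(env_items e1) //.
        by do !apply: env_upd => //.
      by apply: pass_inv_eq inv1 => x xl; rewrite !(upd_in _ _ _ _ xl) //.
    move=> s2 fr2 [S E X V Wn]; have [f2 _] := fr2.
    have sets2 : all_sets i.+2 = all_sets i.+1 ++ fam F its i.+1 by rewrite /all_sets concatS.
    have nexts2 : all_succs i.+1 = all_succs i ++ succs F its i (fam F its i).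
      by rewrite /all_succs concatS.
    ram; unframe f2; rewrite i1 E; split; rewrite /= ?addn1 //; first split.
    * by rewrite cats0 sets2.
    * by rewrite cats0 sets2.
    * by rewrite cats0 nexts2.
    * by move=> z; apply: leq_trans (V z) _.
    * by move=> Z; rewrite ltnNge V.
    * move=> i'; rewrite leq_eqVlt; case: eqP => [-> _|_] /=.
        by rewrite addn2 eqxx [RHS]/start -/(all_sets _) sets2.
      rewrite ltnS => i'i; rewrite addn2 ltn_eqF //; unframe f2; exact: st1.
  + by move=> s1 [f1 _] [_ + _] /= => ->; unframe f1; rewrite (env_N es) addn1 ltnn.
  + move=> s1 _ [[S _ X _ _] _ st]; split=> //.
      by move: S; rewrite cats0.
    by move: X; rewrite cats0.
- by rewrite /pass_time; lia.
Qed.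

End Pass.

(** * Filling the tables and tracing back *)

Section Dynamic.

Variables (n m : nat) (F : cnf n m) (its : seq ('I_n + 'I_m)).
Variables (R : realDomainType) (W : nat -> R).
Hypothesis its_uniq : uniq its.
Hypothesis its_all : forall u, u \in its.

Let N := size its.

Implicit Types (s : state R) (M : nat -> nat -> nat).

Definition memo_of s := Memo (imem s counts) (imem s reached) (imem s preds)
  (imem s bits) (vmem s best).

Let left_sets i := fam F its i.
Let right_sets i := fam F its (N + N - i).

(** For a clause item both steps only remove that clause, so the sum of the masks drops exactly if
    one set contained it. For a variable the first term is already positive, whatever the truncated
    difference is. *)
Lemma active_ok i S S' (b : bool) : i < N ->
  (0 < n - pcode its i + (bitmask S + bitmask S' -
    (bitmask (pstep F its i b S) + bitmask (pstep F its (N + N - i.+1) b S'))))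
  = ok its i S S'.
Proof.
move=> iN; have [in_|[c ic]] := clause_or_var its_uniq its_all iN.
  by rewrite /ok in_ addn_gt0 subn_gt0 in_.
rewrite (ok_clause _ _ ic) /pstep pcode_rev // ic !step_clause.
rewrite (bitmaskD1 S c) (bitmaskD1 S' c); have : 0 < 2 ^ c by rewrite expn_gt0.
move: (2 ^ c) (bitmask _) (bitmask _) => p x y p_gt0.
by case: (c \in S); case: (c \in S'); rewrite ?mul0n ?mul1n /=; lia.
Qed.

Record event_ready i (e : event m) s : Prop := EventReady {
  ready_old : imem s old_base 0 = base m i;
  ready_new : imem s new_base 0 = base m i.+1;
  ready_item : imem s item 0 = pcode its i;
  ready_n : imem s nb_vars 0 = n;
  ready_left : imem s sets (imem s ptr1 0) = bitmask e.1.1;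
  ready_left_next : imem s nexts (imem s ptr1 0 + imem s ptr1 0 + e.2)
    = bitmask (pstep F its i e.2 e.1.1);
  ready_right : imem s sets (imem s ptr2 0) = bitmask e.1.2;
  ready_right_next : imem s nexts (imem s ptr2 0 + imem s ptr2 0 + e.2)
    = bitmask (pstep F its (N + N - i.+1) e.2 e.1.2) }.

Lemma event_runs i t0 es e s : i < N ->
  source_addr F its i e < base m i.+1 ->
  vmem s weights = W ->
  event_ready i e s -> processed F its W i t0 es (memo_of s) ->
  runs (event_prog e.2) s 30 (fun s' => processed F its W i t0 (rcons es e) (memo_of s')).
Proof.
move=> iN src_lt sW [so sn si snv sl sln sr srn] proc.
have okE := active_ok e.1.1 e.1.2 e.2 iN.
have dst_ne : (source_addr F its i e == target_addr F its i e) = false.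
  by rewrite ltn_eqF // (leq_trans src_lt) ?target_ge.
apply: runs_le; first ram.
- rewrite so sn si snv sl sln sr srn -/(addr i _ _) -/(addr i.+1 _ _).
  rewrite -/(source_addr F its i e) -/(target_addr F its i e).
  eapply (runs_post (Q := fun s1 =>
    [/\ forall y, imem s1 counts y = imem s counts y + (target_addr F its i e == y)
        * (event_ok its i e * imem s counts (source_addr F its i e)),
        vmem s1 candidate 0 =
          (vmem s best (source_addr F its i e) + event_gain its W i e)%R
      & vmem s1 best = vmem s best])).
    have cntE C D : (forall y, D y = if y == target_addr F its i e then
          C (target_addr F its i e) + event_ok its i e * C (source_addr F its i e) else C y) ->
        forall y, D y = C y + (target_addr F its i e == y)
          * (event_ok its i e * C (source_addr F its i e)).
      move=> DE y; rewrite DE eq_sym; case: eqP => [<-|_]; first by rewrite mul1n.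
      by rewrite mul0n addn0.
    eapply runs_if => /= c; rewrite okE -/(event_ok its i e) in c; ram.
      eapply runs_if => /= c2; rewrite snv si in c2; ram; split=> //;
        try by apply: cntE => y; rewrite c mul1n.
      * by rewrite /event_gain /gain c2 -/(event_ok its i e) c sW snv si.
      * by rewrite /event_gain /gain (negbTE c2) addr0.
    split=> //.
    * by apply: cntE => y; rewrite (negbTE c) addn0; case: eqP => // ->.
    * by rewrite /event_gain /gain -/(event_ok its i e) (negbTE c) andbF addr0.
  move=> s1 [f1 _] [C1 cand1 V1].
  have [src1 dst1] : imem s1 source_ptr 0 = source_addr F its i e /\
      imem s1 target_ptr 0 = target_addr F its i e by unframe f1.
  have [D1 P1 B1] : [/\ imem s1 reached = imem s reached, imem s1 preds = imem s preds
      & imem s1 bits = imem s bits] by split; unframe f1.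
  eapply runs_if => /= c; rewrite dst1 D1 in c.
    eapply runs_if => /= c2; rewrite dst1 cand1 V1 in c2; ram.
      by apply: (processed_keep src_lt proc); rewrite /= ?D1 ?P1 ?B1 ?V1.
    rewrite src1 dst1 cand1.
    apply: (processed_record src_lt proc); rewrite //= ?D1 ?P1 ?B1 ?V1 //.
    by move=> _; rewrite ltW // ltNge.
  ram; rewrite src1 dst1 cand1.
  apply: (processed_record src_lt proc); rewrite //= ?D1 ?P1 ?B1 ?V1 //.
  by rewrite (negbTE c).
- by [].
Qed.

Lemma listed_eq M M' :
  {in [:: sets; starts; nexts], M' =1 M} -> listed F its M -> listed F its M'.
Proof. by move=> MM' [S X st]; split; rewrite MM'. Qed.

Lemma sets_at M i r : listed F its M -> i <= N + N -> r < size (fam F its i) ->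
  M sets (start F its i + r) = bitmask (nth set0 (fam F its i) r).
Proof.
move=> [S _ _] iN ri; rewrite S; first by rewrite nth_concat.
rewrite -[size _]/(start F its (N + N).+1); apply: (@leq_trans (start F its i.+1)).
  by rewrite startS ltn_add2l.
by rewrite /start -(subnKC (iN : i < (N + N).+1)) /concat iotaD map_cat flatten_cat size_cat leq_addr.
Qed.

Lemma nexts_at M i r (b : bool) : listed F its M -> i < N + N -> r < size (fam F its i) ->
  M nexts (start F its i + r + (start F its i + r) + b)
  = bitmask (pstep F its i b (nth set0 (fam F its i) r)).
Proof.
move=> [_ X _] iN ri.
have rb : r.*2 + b < size (succs F its i (fam F its i)).
  by rewrite size_succs; case: b; lia.
have -> : start F its i + r + (start F its i + r) + b =
    size (all_succs F its i) + (r.*2 + b).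
  by rewrite size_all_succs; lia.
rewrite X; first by rewrite nth_concat // nth_succs.
apply: (@leq_trans (size (all_succs F its i.+1))).
  by rewrite /all_succs [X in _ < size X]concatS size_cat ltn_add2l.
by rewrite !size_all_succs leq_double /start -(subnKC iN) /concat iotaD map_cat flatten_cat size_cat leq_addr.
Qed.

Record step_ready i s : Prop := StepReady {
  step_env : env F its (imem s);
  step_listed : listed F its (imem s);
  step_index : imem s index 0 = i;
  step_item : imem s item 0 = pcode its i;
  step_old : imem s old_base 0 = base m i;
  step_new : imem s new_base 0 = base m i.+1;
  step_weights : vmem s weights = W }.

Definition step_arrays :=
  env_arrays ++ [:: sets; starts; nexts; index; item; old_base; new_base].

Lemma step_ready_eq i s s' : {in step_arrays, imem s' =1 imem s} ->
  vmem s' weights = vmem s weights -> step_ready i s -> step_ready i s'.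
Proof.
move=> ss' ww [e l si sit so sn sw].
split; rewrite ?ss' ?ww //.
  by apply: env_eq e => x xa; rewrite ss' // mem_cat xa.
by apply: listed_eq l => x xa; rewrite ss' // mem_cat; apply/orP; right;
  move: x xa; apply/allP.
Qed.

Lemma step_ready_frame p i s s' : frame p s s' ->
  all (fun x => x \notin ints_written p) step_arrays -> weights \notin weights_written p ->
  step_ready i s -> step_ready i s'.
Proof.
move=> fr ok okw; apply: step_ready_eq; first exact: frame_in fr ok.
by case: fr => _ ->.
Qed.

Lemma step_ready_upd i s x j v : x \notin step_arrays -> step_ready i s ->
  step_ready i (State (upd (imem s) x j v) (vmem s)).
Proof. by move=> xa; apply: step_ready_eq => //; apply: upd_in. Qed.

Lemma step_event_ready i p q (b : bool) s (S := nth set0 (left_sets i) p)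
    (S' := nth set0 (right_sets i.+1) q) :
  i < N -> step_ready i s -> p < size (left_sets i) -> q < size (right_sets i.+1) ->
  imem s ptr1 0 = start F its i + p ->
  imem s ptr2 0 = start F its (N + N - i.+1) + q ->
  event_ready i (S, S', b) s.
Proof.
move=> iN [e l si sit so sn sw] pL qL p1 p2.
split=> //=; rewrite ?p1 ?p2 ?(env_n e) //.
- by rewrite (sets_at l) //; lia.
- by rewrite (nexts_at _ l) //; lia.
- by rewrite (sets_at l) //; lia.
- by rewrite (nexts_at _ l) //; lia.
Qed.

Variable width : nat.
Hypothesis fam_width : forall i, i <= N + N -> size (fam F its i) <= width.

Lemma row_events_rcons i (S S' : {set 'I_m}) l :
  row_events its i S (rcons l S') = row_events its i S l ++ pair_events its i S S'.
Proof. by rewrite /row_events map_rcons flatten_rcons. Qed.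

Lemma row_runs i t0 p es s (S := nth set0 (left_sets i) p) :
  i < N -> step_ready i s -> p < size (left_sets i) ->
  imem s ptr1 0 = start F its i + p ->
  processed F its W i t0 es (memo_of s) ->
  runs row_prog s (width * 80 + 10) (fun s' => processed F its W i t0
    (es ++ row_events its i S (right_sets i.+1)) (memo_of s')).
Proof.
move=> iN rdy pL p1 proc; set L := right_sets i.+1.
have [e l si sit so sn sw] := rdy.
have st j : j <= N + N -> imem s starts j = start F its j by move=> jN; apply: listed_starts l _ _; lia.
have SL : S \in left_sets i by apply: mem_nth.
have iS : (N + N - i.+1).+1 = N + N - i by lia.
apply: runs_le; first ram.
- rewrite si (env_N e) addn1 st ?leq_subr //.
  apply: runs_post (runs_while (h := size L) (I := fun q s' =>
    processed F its W i t0 (es ++ row_events its i S (take q L)) (memo_of s')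
    /\ imem s' ptr2 0 = start F its (N + N - i.+1) + q) _ _ _) _.
  + by rewrite take0 cats0 /= addn0.
  + move=> q s1 fr1 qL [proc1 p2]; have [f1 _] := fr1.
    have rdy1 : step_ready i s1.
      by apply: step_ready_frame fr1 _ _ _ => //; apply: step_ready_upd.
    have [e1 l1 si1 sit1 so1 sn1 sw1] := rdy1.
    have p11 : imem s1 ptr1 0 = start F its i + p by unframe f1.
    have S'L : nth set0 L q \in right_sets i.+1 by apply: mem_nth.
    split.
      rewrite /= p2 si1 (env_N e1) -iS (listed_starts l1) ?startS; last by lia.
      by rewrite addn1 -addnS leq_add2l.
    have src (b : bool) : source_addr F its i (S, nth set0 L q, b) < base m i.+1.
      have H := right_step its_uniq b iN S'L; exact: (addr_lt its_uniq its_all (ltnW iN) SL H).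
    eapply runs_bind.
      apply: (event_runs (e := (S, nth set0 L q, false)) iN _ sw1 _ proc1) => //.
      exact: step_event_ready.
    move=> s2 fr2 proc2; have [f2 _] := fr2.
    have rdy2 : step_ready i s2 by apply: step_ready_frame fr2 _ _ rdy1.
    have [e2 l2 si2 sit2 so2 sn2 sw2] := rdy2.
    eapply runs_bind.
      (* A clause item has no event with value true, in accordance with [branches]. *)
      eapply (@runs_if _ _ _ _ _ _ _ (fun s3 => processed F its W i t0
        (es ++ row_events its i S (take q.+1 L)) (memo_of s3))) => /= c;
        rewrite (env_n e2) sit2 in c.
        ram; rewrite (take_nth set0 qL) row_events_rcons /pair_events /branches ltnNge c /=.
        by rewrite catA cats1.
      apply: runs_post.
        apply: (event_runs (e := (S, nth set0 L q, true)) iN _ sw2 _ proc2) => //.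
        by apply: step_event_ready => //; unframe f2.
      move=> s3 _; rewrite (take_nth set0 qL) row_events_rcons /pair_events /branches ltnNge c /=.
      by rewrite catA -!cats1 -!catA.
    move=> s3 fr3 proc3; have [f3 _] := fr3.
    by ram; split=> //=; unframe f3; unframe f2; rewrite p2 addn1 addnS.
  + move=> s1 fr1 [_ p2]; have [f1 _] := fr1; rewrite /= p2; unframe f1.
    rewrite si (env_N e) -iS st ?startS ?addn1 ?ltnn //; by lia.
  + by move=> s1 _ []; rewrite take_size.
- have := fam_width (leq_subr i.+1 (N + N)); rewrite -/(right_sets _) -/L => sL.
  rewrite !add1n; apply: (@leq_trans (width * 80).+2); last by lia.
  by rewrite !ltnS leq_mul.
Qed.

Lemma events_rcons i (S : {set 'I_m}) l :
  events F its i (rcons l S) = events F its i l ++ row_events its i S (right_sets i.+1).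
Proof. by rewrite /events map_rcons flatten_rcons. Qed.

Lemma rows_runs i s (L := left_sets i) (t0 := memo_of s) :
  i < N -> step_ready i s -> imem s ptr1 0 = start F its i ->
  table F its W i t0 ->
  runs (while $ptr1 + #1 <= starts ! ($index + #1) do
      row_prog ;; put ptr1 := $ptr1 + #1 od)%ram s (width * (width * 80 + 12)).+1
    (fun s' => processed F its W i t0 (events F its i L) (memo_of s')).
Proof.
move=> iN rdy p1 tab0.
have [e l si sit so sn sw] := rdy.
apply: runs_weak (runs_while (h := size L) (T := width * 80 + 11) (I := fun p s' =>
  processed F its W i t0 (events F its i (take p L)) (memo_of s')
  /\ imem s' ptr1 0 = start F its i + p) _ _ _) _ _.
- by rewrite take0 addn0; split=> //; apply: processed0.
- move=> p s1 fr1 pL [proc1 p11]; have [f1 _] := fr1.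
  have rdy1 : step_ready i s1 by apply: step_ready_frame fr1 _ _ rdy.
  split.
    rewrite /= p11; unframe f1; rewrite si !addn1 (listed_starts l) ?startS; last by lia.
    by rewrite -addnS leq_add2l.
  apply: runs_le; first (eapply runs_bind; first exact: row_runs pL p11 proc1).
    move=> s2 [f2 _] proc2; ram; split.
      by rewrite (take_nth set0 pL) events_rcons.
    by unframe f2; rewrite p11 addn1 addnS.
  by rewrite addn1 -addnS.
- move=> s1 fr1 [_ p11]; have [f1 _] := fr1; rewrite /= p11; unframe f1.
  by rewrite si !addn1 (listed_starts l) ?startS ?ltnn //; lia.
- rewrite ltnS -addnS leq_mul // fam_width //; lia.
- by move=> s1 _ []; rewrite take_size.
Qed.

Definition table_time := N * (width * (width * 80 + 12) + 10) + 10.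

Lemma table_runs s :
  env F its (imem s) -> listed F its (imem s) -> vmem s weights = W ->
  (forall y, imem s counts y = 0) -> (forall y, imem s reached y = 0) ->
  (forall y, imem s preds y = 0) -> (forall y, vmem s best y = 0%R) ->
  runs table_prog s table_time (fun s' =>
    table F its W N (memo_of s') /\ imem s' old_base 0 = base m N).
Proof.
move=> e l sw C0 D0 P0 V0.
apply: runs_le; first ram.
- apply: runs_post (runs_while (h := N) (I := fun i s' =>
    [/\ table F its W i (memo_of s'), imem s' index 0 = i
      & imem s' old_base 0 = base m i]) _ _ _) _.
  + split=> //; apply: table0 => // y /=; rewrite ?C0 ?D0 ?P0 ?V0 //; by case: y.
  + move=> i s1 fr1 iN [tab1 si so]; have [f1 g1] := fr1.
    have e1 : env F its (imem s1).
      by apply: env_frame fr1 isT _; do !apply: env_upd => //.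
    have l1 : listed F its (imem s1).
      by apply: listed_eq l => x xl; rewrite (frame_in fr1 _ xl) //= !(upd_in _ _ _ _ xl).
    split; first by rewrite /= si (env_N e1) addn1.
    ram; rewrite si so (env_power e1) (env_items e1) ?ltn_addr // (listed_starts l1); last by lia.
    eapply runs_post.
      apply: (rows_runs iN) => //=; split=> //=.
      - by do !apply: env_upd => //.
      - by apply: listed_eq l1 => x xl; rewrite !(upd_in _ _ _ _ xl).
      - by rewrite baseS.
      - by rewrite g1.
    move=> s2 [f2 _] proc2; ram; unframe f2; split; rewrite ?si ?addn1 ?baseS //.
    exact: (table_step its_uniq its_all iN tab1 proc2).
  + by move=> s1 [f1 _] [_ + _] /= => ->; unframe f1; rewrite (env_N e) addn1 ltnn.
  + by move=> s1 _ [].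
- by rewrite /table_time; lia.
Qed.

Lemma trace_runs s :
  env F its (imem s) -> imem s old_base 0 = base m N -> (forall y, imem s 1 y = 0) ->
  runs trace_prog s (N * 20 + 10) (fun s' =>
    forall x : 'I_n, imem s' 1 x = trace its (memo_of s) N (base m N) x).
Proof.
move=> e so out0; set t := memo_of s; set a := trace its t N (base m N).
apply: runs_le; first ram.
(* After [j] rounds, variables from the position [N - j] on are output, and the trace from the
   current pointer still agrees with [a] on the others. *)
- apply: runs_post (runs_while (h := N) (I := fun j s' => let y := imem s' source_ptr 0 in
    [/\ imem s' index 0 = N - j,
        forall x : 'I_n, pos its (inl x) < N - j ->
          trace its t (N - j) y x = a x /\ imem s' 1 x = 0
      & forall x : 'I_n, N - j <= pos its (inl x) -> imem s' 1 x = a x]) _ _ _) _.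
  + rewrite /= subn0 (env_N e) so; split=> // x.
    by rewrite leqNgt pos_lt.
  + move=> j s1 fr1 jN /= [i1 low high]; have [f1 _] := fr1.
    have [i Ei] : exists i, N - j.+1 = i by exists (N - j.+1).
    have iN : i < N by lia.
    have Sji : N - j = i.+1 by lia.
    rewrite Ei; rewrite Sji in i1 low high.
    have e1 : env F its (imem s1).
      by apply: env_frame fr1 isT _; do !apply: env_upd => //.
    have [P1 B1] : imem s1 preds = pred_of t /\ imem s1 bits = bit_of t by split; unframe f1.
    split; first by rewrite i1.
    set y := imem s1 source_ptr 0 in low.
    have iE : pcode its i < n -> exists x : 'I_n, pcode its i = x /\ pos its (inl x) = i.
      have [[x|c] ui] := pos_surj its_uniq iN; rewrite -ui pcode_pos //=.
        by exists x.
      by rewrite ltnNge leq_addr.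
    have goalE s2 : imem s2 index 0 = i -> imem s2 source_ptr 0 = pred_of t y ->
        (forall x : 'I_n, imem s2 1 x =
          if x == pcode its i :> nat then nat_of_bool (0 < bit_of t y) else imem s1 1 x) ->
        [/\ imem s2 index 0 = i,
          forall x : 'I_n, pos its (inl x) < i ->
            trace its t i (imem s2 source_ptr 0) x = a x /\ imem s2 1 x = 0
        & forall x : 'I_n, i <= pos its (inl x) -> imem s2 1 x = a x].
      move=> i2 src2 out2; split=> // x xi.
        have [+ o1] := low x (ltnW xi); rewrite src2 out2 o1 ffunE /=.
        case: eqP => // xE _; have := xi; have [|x' [x'E <-]] := iE.
          by rewrite -xE.
        by rewrite (val_inj (etrans xE x'E)) ltnn.
      rewrite out2; case: eqP => [xE|xE].
        have [|x' [x'E x'i]] := iE; first by rewrite -xE.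
        have [|+ _] := low x; first by rewrite (val_inj (etrans xE x'E)) x'i.
        by rewrite ffunE /= xE eqxx => ->.
      apply: high; move: xi; rewrite leq_eqVlt => /orP[/eqP xi|//].
      by case: xE; rewrite xi pcode_pos.
    ram; rewrite i1 subn1 /=.
    eapply (runs_post (Q := fun s2 => forall x : 'I_n, imem s2 1 x =
        if x == pcode its i :> nat then nat_of_bool (0 < bit_of t y) else imem s1 1 x)).
      have itE : imem s1 items i = pcode its i by rewrite (env_items e1) ?ltn_addr.
      eapply runs_if => /= c; rewrite (env_n e1) itE in c; ram.
        by move=> x; case: eqP => // xE; have := ltn_ord x; rewrite [nat_of_ord x]xE; lia.
      eapply runs_if => /= c2; rewrite B1 in c2; ram => x.
        by rewrite itE c2.
      case: eqP => // xE; rewrite (negbTE c2).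
      have [|x' [x'E x'i]] := iE; first by rewrite -xE.
      by have [|_ ->] := low x; rewrite // (val_inj (etrans xE x'E)) x'i.
    move=> s2 fr2 out2; have [f2 _] := fr2; ram.
    apply: (goalE (State (upd (imem s2) source_ptr 0
      (imem s2 preds (imem s2 source_ptr 0))) (vmem s2))) => //=; unframe f2 => //.
    by rewrite P1.
  + by move=> s1 fr1 [+ _ _] /= => ->; rewrite subnn.
  + by move=> s1 _ /= [_ _ H] x; apply: H; rewrite subnn.
- by lia.
Qed.

End Dynamic.

(** * Positions in the sorted listing *)

Section Listing.

Variables (n m : nat) (lt : rel ('I_n + 'I_m)).
Hypothesis lt_order : strict_total_order lt.

Lemma listing_uniq : uniq (listing lt).
Proof. by rewrite sort_uniq enum_uniq. Qed.

Lemma mem_listing u : u \in listing lt.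
Proof. by rewrite mem_sort mem_enum. Qed.

Lemma lt_pos u v : lt u v = (pos (listing lt) u < pos (listing lt) v).
Proof.
have [irr tr tot] := lt_order.
pose le u v := (u == v) || lt u v.
have le_tot : total le.
  move=> x y; rewrite /le; case: (eqVneq x y) => //= /tot /orP[] -> //.
  by rewrite !orbT.
have le_tr : transitive le.
  move=> y x z /orP[/eqP -> //|xy] /orP[/eqP <-|yz]; rewrite /le ?xy ?orbT //.
  by rewrite (tr y) ?orbT.
have lt_of x y : pos (listing lt) x < pos (listing lt) y -> lt x y.
  move=> xy; have /orP[/eqP E|//] : le x y.
    have := sorted_ltn_index le_tr (sort_sorted le_tot (enum {: 'I_n + 'I_m})).
    by apply; rewrite ?mem_listing.
  by move: xy; rewrite E ltnn.
apply/idP/idP => [uv|/lt_of //]; rewrite ltnNge leq_eqVlt negb_or.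
apply/andP; split.
  apply: contraTneq uv => /(pos_inj mem_listing) ->; by rewrite irr.
by apply/negP=> /lt_of vu; have := tr _ _ _ uv vu; rewrite irr.
Qed.

End Listing.

(** * Total running time *)

Lemma total_time_bound n m k N w : 0 < m -> N = n + m -> w = (m * 2 ^ k).+1 ->
  m * (n * 10 + 20) + N * 10 + 30 + ((N + N) * (w * (m * 40 + 60) + 10) + 10
    + (N * (w * (w * 80 + 12) + 10) + 10)) + (N * 20 + 10)
  <= 1000 * (m ^ 3 * 4 ^ k * (m + n)).
Proof.
move=> m0 NE ->.
have q0 : 0 < 2 ^ k by rewrite expn_gt0.
have -> : 4 ^ k = 2 ^ k * 2 ^ k by rewrite -expnMn.
rewrite [m + n]addnC -NE; move: (2 ^ k) q0 => q q0.
have [x Ex] : exists x, x = m * q by eexists.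
have N0 : 0 < N by lia.
have mx : m <= x by rewrite Ex leq_pmulr.
have -> : m ^ 3 * (q * q) * N = m * (x * x * N) by rewrite Ex; ring.
(* [Y] equals [m ^ 2 * 4 ^ k * (m + n)], the order of the number of events; every term of the
   running time is a bounded multiple of it. *)
set Y := x * x * N.
have Yle a b : a <= x * x -> b <= N -> a * b <= Y by move=> ax bN; rewrite leq_mul.
have xx : x <= x * x by rewrite leq_pmulr // (leq_trans m0).
have YN : N <= Y by rewrite -[N]mul1n leq_mul // (leq_trans m0) // (leq_trans mx).
have Ym : m <= Y by rewrite -[m]muln1 Yle // (leq_trans mx).
have Ymn : m * n <= Y by rewrite Yle ?(leq_trans mx) // NE leq_addr.
rewrite -Ex.
have w2 : x.+1 <= 2 * x by lia.
have Yp : N * (x.+1 * (m * 40 + 60)) <= 200 * Y.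
  rewrite [200 * Y](_ : _ = N * (2 * x * (100 * x))); last by rewrite /Y; ring.
  by rewrite leq_mul // leq_mul //; lia.
have Yt : N * (x.+1 * (x.+1 * 80 + 12)) <= 344 * Y.
  rewrite [344 * Y](_ : _ = N * (2 * x * (172 * x))); last by rewrite /Y; ring.
  by rewrite leq_mul // leq_mul //; lia.
(* The remaining factor [m] of the claimed bound is supplied here, from [0 < m]. *)
have mY : Y <= m * Y by rewrite leq_pmull.
apply: leq_trans (leq_mul (leqnn 1000) mY).
move: (x.+1) w2 Yp Yt => v w2 Yp Yt.
have -> : m * (n * 10 + 20) + N * 10 + 30 + ((N + N) * (v * (m * 40 + 60) + 10) + 10
    + (N * (v * (v * 80 + 12) + 10) + 10)) + (N * 20 + 10)
  = 10 * (m * n) + 20 * m + 60 * N + 60 + 2 * (N * (v * (m * 40 + 60)))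
    + N * (v * (v * 80 + 12)) by ring.
(* The coefficients 10, 20, 60, 60, 400 and 344 of the multiples of [Y] sum to 894, below 1000. *)
by lia.
Qed.

(** * Assembling the two algorithms *)

Section Solution.

Variables (R : realDomainType) (k n m : nat) (F : cnf n m) (lt : rel ('I_n + 'I_m)).
Hypothesis lt_interval : interval_ordering k F lt.

Let its := listing lt.
Let N := size its.
Let width := (m * 2 ^ k).+1.

Let its_uniq : uniq its. Proof. exact: listing_uniq. Qed.
Let its_all u : u \in its. Proof. exact: mem_listing. Qed.

Let fam_width i : i <= N + N -> size (fam F its i) <= width.
Proof.
have [ord card_le] := lt_interval.
by apply: size_fam card_le _ => // u v; apply: lt_pos.
Qed.

Definition solve_time := setup_time its + (pass_time its width + table_time its width).

Lemma solve_runs (ws : seq R) :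
  runs solve_prog (initial_state (code_input F lt) ws) solve_time (fun s =>
    [/\ env F its (imem s), table F its (nth 0%R ws) N (memo_of s),
        imem s old_base 0 = base m N & forall y, imem s 1 y = 0]).
Proof.
eapply runs_bind; first exact: (setup_runs its_uniq its_all).
move=> s1 [f1 g1] e1; eapply runs_bind.
  apply: (pass_runs its_uniq its_all fam_width e1) => z; by unframe f1.
move=> s2 fr2 l2; have [f2 g2] := fr2.
have e2 := env_frame fr2 isT e1.
have w2 : vmem s2 weights = nth 0%R ws by rewrite g2 ?g1.
apply: runs_post.
  apply: (table_runs its_uniq its_all fam_width e2 l2 w2) => y.
  - by unframe f2; unframe f1.
  - by unframe f2; unframe f1.
  - by unframe f2; unframe f1.
  - by rewrite g2 ?g1.
move=> s3 fr3 [tab3 ob3]; have [f3 _] := fr3.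
split=> //; first exact: env_frame fr3 isT e2.
by move=> y; unframe f3; unframe f2; unframe f1.
Qed.

Lemma solve_time_bound : 0 < m ->
  solve_time + (N * 20 + 10) <= 1000 * (m ^ 3 * 4 ^ k * (m + n)).
Proof. by move=> m0; apply: total_time_bound => //; apply: size_items. Qed.

End Solution.

Theorem theorem9 :
  (exists (p : prog) (c : nat),
     forall (R : realDomainType) (k n m : nat) (F : cnf n m)
            (lt : rel ('I_n + 'I_m)),
       interval_ordering k F lt ->
       exists (t : nat) (s : state R),
         [/\ exec p (initial_state (code_input F lt) [::]) t s,
             (0 < m -> t <= c * (m ^ 3 * 4 ^ k * (m + n)))
           & count_output F s])
  /\
  (exists (p : prog) (c : nat),
     forall (R : realDomainType) (k n m : nat) (F : cnf n m)
            (lt : rel ('I_n + 'I_m)) (w : 'I_m -> R),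
       interval_ordering k F lt ->
       exists (t : nat) (s : state R),
         [/\ exec p (initial_state (code_input F lt)
                       [seq w j | j <- enum 'I_m]) t s,
             (0 < m -> t <= c * (m ^ 3 * 4 ^ k * (m + n)))
           & maxsat_output F w s]).
Proof.
split.
- exists count_prog, 1000 => R k n m F lt lt_int.
  have [t [s [st tT out]]] : runs count_prog
      (initial_state (code_input F lt) ([::] : seq R))
      (solve_time k lt + 1) (count_output F).
    eapply runs_bind; first exact: solve_runs lt_int _.
    move=> s _ [_ tab ob _]; ram; rewrite /count_output /= ob.
    exact: (table_count (listing_uniq lt) (mem_listing lt) tab).
  exists t, s; split=> // m0; apply: leq_trans tT _.
  by apply: leq_trans (solve_time_bound k lt m0); rewrite leq_add2l addn_gt0 orbT.
- exists maxsat_prog, 1000 => R k n m F lt w lt_int.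
  have [t [s [st tT out]]] : runs maxsat_prog
      (initial_state (code_input F lt) [seq w j | j <- enum 'I_m])
      (solve_time k lt + (size (listing lt) * 20 + 10)) (maxsat_output F w).
    eapply runs_bind; first exact: solve_runs lt_int _.
    move=> s1 _ [e1 tab ob out0]; apply: runs_post.
      exact: (trace_runs (listing_uniq lt) (mem_listing lt) e1 ob out0).
    move=> s2 _ out2; exists (trace (listing lt) (memo_of s1) (size (listing lt))
      (base m (size (listing lt)))); split=> //.
    apply: (table_maximum (listing_uniq lt) (mem_listing lt) tab) => j.
    by rewrite (nth_map j) ?nth_ord_enum // size_enum_ord.
  exists t, s; split=> // m0; apply: leq_trans tT _.
  exact: solve_time_bound.
Qed.
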